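(* Assume that $\theta$ is not supported by a strict subgroup of $\mathbb Z^d$. Let $W_{\mathcal T_\infty}$ be the $\mathcal T_\infty$-walk with $\theta$-jumps started at $0$ (i.e. $W_{\mathcal T_\infty}(c_0)=0$), and define the events $$\mathrm{Esc}=\bigl(W_{\mathcal T_\infty}(u)\neq 0\ \ \forall u\in\mathcal T_\infty\setminus\{c_0\}\bigr),\qquad \mathrm{Esc}_+=\bigl(W_{\mathcal T_\infty}(u)\neq 0\ \ \forall u\in\mathcal T_+\bigr).$$ (i) If $\mathbb P(\mathrm{Esc})=0$ then almost surely, for every $x\in\mathbb Z^d$, $\sum_{u\in\mathcal T_\infty}\mathbf 1_{W_{\mathcal T_\infty}(u)=x}=+\infty$. (ii) If $\mathbb P(\mathrm{Esc})>0$ then almost surely, for every $x\in\mathbb Z^d$, $\sum_{u\in\mathcal T_\infty}\mathbf 1_{W_{\mathcal T_\infty}(u)=x}<+\infty$. Moreover, $\mathbb P(\mathrm{Esc})=0$ if and only if $\mathbb P(\mathrm{Esc}_+)=0$; and in the recurrent case (that is, when these probabilities are $0$), almost surely, for every $x\in\mathbb Z^d$, $\sum_{u\in\mathcal T_+}\mathbf 1_{W_{\mathcal T_\infty}(u)=x}=+\infty$.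
   Context: Offspring distribution: $\mu$ is a probability distribution on $\mathbb N=\{0,1,2,\dots\}$, critical ($\sum_k k\mu(k)=1$ and $\mu\neq\delta_1$), and $\mu\in\mathrm{dom}(\alpha)$ for some $\alpha\in(1,2]$, i.e. its generating function $\mathrm{Gen}_\mu(s)=\sum_k\mu(k)s^k$ satisfies $\mathrm{Gen}_\mu(1-s)-(1-s)=s^\alpha L(1/s)$ for $s\in(0,1]$, where $L$ is a slowly varying function at $+\infty$. Jump distribution: $\theta$ is a centered probability distribution on $\mathbb Z^d$ with (finite) invertible covariance matrix. Infinite tree $\mathcal T_\infty$: it has an infinite spine of vertices $(c_0,c_{-1},c_{-2},\dots)$ in which $c_{-i-1}$ is the parent of $c_{-i}$ for all $i\ge0$; $c_0$ is called the cursor. Independently for $k\ge1$, $c_{-k}$ has a number of children distributed according to the size-biased law $\mu'(j)=j\mu(j)$, and $c_{-k+1}$ is placed uniformly among these (ordered) children. All other vertices, including $c_0$, have independent numbers of (ordered) children distributed according to $\mu$. Depth-first order $\preceq$ on $\mathcal T_\infty$: $u\preceq v$ iff $u$ is $v$ or an ancestor of $v$, or, with $w$ the last common ancestor of $u,v$, the child of $w$ that is equal to or an ancestor of $u$ comes before the child of $w$ that is equal to or an ancestor of $v$. Future of the cursor: $\mathcal T_+=\{u\in\mathcal T_\infty: c_0\prec u\}$ (strict order). $\mathcal T_\infty$-walk started at $x$: $W(c_0)=x$ and, given the tree, for every edge from a parent $v$ to a child $u$ the increments $W(u)-W(v)$ are i.i.d. with law $\theta$. *)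

(* Defs.v *)
From HB Require Import structures.
From mathcomp Require Import all_boot all_order all_algebra finmap.
From mathcomp Require Import all_classical all_reals all_analysis.
Import Order.TTheory GRing.Theory Num.Theory.
Import numFieldNormedType.Exports.

Set Implicit Arguments.
Unset Strict Implicit.
Unset Printing Implicit Defensive.

Local Open Scope classical_set_scope.
Local Open Scope ring_scope.

(* Z^d with the discrete sigma-algebra.  The alias is only there to carry the
   measurable structure. *)
Definition lattice (d : nat) : Type := 'rV[int]_d.

HB.instance Definition _ (d : nat) := GRing.Zmodule.on (lattice d).
HB.instance Definition _ (d : nat) := Countable.on (lattice d).
HB.instance Definition _ (d : nat) := isPointed.Build (lattice d) 0.
HB.instance Definition _ (d : nat) :=
  @isMeasurable.Build default_measure_display (lattice d)
    (@discrete_measurable (lattice d)) (@discrete_measurable0 (lattice d))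
    (@discrete_measurableC (lattice d)) (@discrete_measurableU (lattice d)).

Definition critical (R : realType) (mu : probability nat R) : Prop :=
  (\sum_(0 <= k <oo) (k%:R%:E * mu [set k]) = 1)%E /\
  ~ (forall A : set nat, mu A = \d_(1%N) A).

Definition Gen (R : realType) (mu : probability nat R) (s : R) : \bar R :=
  (\sum_(0 <= k <oo) (mu [set k] * (s ^+ k)%:E))%E.

Definition slowly_varying (R : realType) (L : R -> R) : Prop :=
  (exists x0 : R, [/\ 0 < x0, measurable_fun `[x0, +oo[ L &
     forall x, x0 <= x -> 0 < L x]) /\
  (forall c : R, 0 < c -> L (c * x) / L x @[x --> +oo] --> (1 : R)).

Definition dom (R : realType) (alpha : R) (mu : probability nat R) : Prop :=
  exists2 L : R -> R, slowly_varying L &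
    forall s : R, 0 < s <= 1 ->
      (Gen mu (1 - s) - (1 - s)%:E = (s `^ alpha * L s^-1)%:E)%E.

Definition size_biased (R : realType) (mu : probability nat R) (j : nat) :
  \bar R := (j%:R%:E * mu [set j])%E.

Definition lattice_coord (R : realType) (d : nat) (i : 'I_d) (x : lattice d) : R :=
  ((x : 'rV[int]_d) 0 i)%:~R.

Definition centered (R : realType) (d : nat)
    (theta : probability (lattice d) R) : Prop :=
  forall i : 'I_d, ('E_theta[@lattice_coord R d i] = 0)%E.

Definition finite_second_moments (R : realType) (d : nat)
    (theta : probability (lattice d) R) : Prop :=
  forall i : 'I_d, @lattice_coord R d i \in Lfun theta 2%:E.

Definition covariance_mx (R : realType) (d : nat)
    (theta : probability (lattice d) R) : 'M[R]_d :=
  \matrix_(i, j) fine (covariance theta (@lattice_coord R d i) (@lattice_coord R d j)).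

Definition is_subgroup (d : nat) (H : set (lattice d)) : Prop :=
  H 0 /\ forall x y, H x -> H y -> H (x - y).

Definition not_supported_by_strict_subgroup (R : realType) (d : nat)
    (theta : probability (lattice d) R) : Prop :=
  forall H : set (lattice d), is_subgroup H -> (theta H = 1)%E -> H = setT.

(* The label (k, w) is the vertex reached from c_{-k} by the Ulam-Harris word w;
   in particular c_{-k} is (k, [::]).  The vertex c_{-k} is itself a child of
   c_{-k-1} and is always labelled (k, [::]), so when i is the rank of c_{-k}
   the label (k.+1, [:: i]) and its extensions are not used.

   A tree is coded by
   - N u, the number of children of u, used when u is c_0 or lies off the spine,
   - S k, for k : nat, the pair (number of children of c_{-k-1}, rank of c_{-k}
     among these children), ranks starting from 0. *)

Definition vertex : Type := (nat * seq nat)%type.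
HB.instance Definition _ := Countable.on vertex.

Definition spine_vertex (k : nat) : vertex := (k, [::]).
Definition cursor : vertex := spine_vertex 0.

Definition nchildren (N : vertex -> nat) (S : nat -> nat * nat) (u : vertex) :
  nat := if u is (k.+1, [::]) then (S k).1 else N u.

Definition child (S : nat -> nat * nat) (u : vertex) (i : nat) : vertex :=
  match u with
  | (k.+1, [::]) => if i == (S k).2 then spine_vertex k else (k.+1, [:: i])
  | (k, w) => (k, rcons w i)
  end.

Inductive in_tree (N : vertex -> nat) (S : nat -> nat * nat) : vertex -> Prop :=
| in_tree_spine k : in_tree N S (spine_vertex k)
| in_tree_child u i : in_tree N S u -> (i < nchildren N S u)%N ->
    in_tree N S (child S u i).

Definition tree (N : vertex -> nat) (S : nat -> nat * nat) : set vertex :=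
  [set u | in_tree N S u].

Definition parent (u : vertex) : vertex :=
  match u with
  | (k, [::]) => spine_vertex k.+1
  | (k, i :: w) => (k, belast i w)
  end.

Lemma parent_rcons k w i : parent (k, rcons w i) = (k, w).
Proof.
case: w => [|j w] //=.
by rewrite belast_rcons.
Qed.

Definition rank (S : nat -> nat * nat) (u : vertex) : nat :=
  match u with
  | (k, [::]) => (S k).2
  | (_, i :: w) => last i w
  end.

Lemma parent_child S u i : parent (child S u i) = u.
Proof.
case: u => -[|k] [|j w] //=; rewrite ?belast_rcons //.
by case: ifP.
Qed.

Lemma rank_child S u i : rank S (child S u i) = i.
Proof.
case: u => -[|k] [|j w] //=; rewrite ?last_rcons //.
by case: ifP => //= /eqP ->.
Qed.

Lemma tree_parent N S u : tree N S u -> tree N S (parent u).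
Proof.
by case=> [k|{}u i Hu _]; [exact: in_tree_spine|rewrite parent_child].
Qed.

Definition ancestor_or_self (u v : vertex) : Prop :=
  exists n, iter n parent v = u.

Definition last_common_ancestor (w u v : vertex) : Prop :=
  [/\ ancestor_or_self w u, ancestor_or_self w v &
      forall z, ancestor_or_self z u -> ancestor_or_self z v ->
        ancestor_or_self z w].

Definition depth_first_le (S : nat -> nat * nat) (u v : vertex) : Prop :=
  ancestor_or_self u v \/
  exists w a b, [/\ last_common_ancestor w u v,
    parent a = w /\ parent b = w,
    ancestor_or_self a u /\ ancestor_or_self b v &
    (rank S a < rank S b)%N].

Definition tree_future (N : vertex -> nat) (S : nat -> nat * nat) :
  set vertex :=
  [set u | [/\ tree N S u, depth_first_le S cursor u & u <> cursor]].

(* X u is the increment along the edge from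
   parent u to u, so that the path from c_0 down to u first climbs k edges
   of the spine, whose increments are subtracted. *)

Definition walk (d : nat) (x : lattice d) (X : vertex -> lattice d)
    (u : vertex) : lattice d :=
  x - \sum_(0 <= j < u.1) X (spine_vertex j)
    + \sum_(1 <= l < (size u.2).+1) X (u.1, take l u.2).

Lemma walk_cursor d (x : lattice d) X : walk x X cursor = x.
Proof. by rewrite /walk /= !big_geq // subr0 addr0. Qed.

Lemma walk_parent d (x : lattice d) X u :
  walk x X u - walk x X (parent u) = X u.
Proof.
case: u => k w; case/lastP: w => [|w i].
  rewrite /walk /= (@big_nat_recr _ _ _ k 0) //= !(@big_geq _ _ _ 1 1) // !addr0.
  by rewrite opprB addrCA (addrAC x) subrr add0r addrAC subrr add0r.
rewrite parent_rcons /walk /= size_rcons (@big_nat_recr _ _ _ (size w).+1) //=.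
rewrite take_oversize ?size_rcons //.
have -> : \sum_(1 <= l < (size w).+1) X (k, take l (rcons w i)) =
          \sum_(1 <= l < (size w).+1) X (k, take l w).
  by apply: eq_big_nat => l /andP[_]; rewrite ltnS -cats1 => /takel_cat ->.
by rewrite addrA [LHS]addrAC subrr add0r.
Qed.

Definition visits (R : realType) (d : nat) (A : set vertex)
    (W : vertex -> lattice d) (x : lattice d) : \bar R :=
  \esum_(u in A) ((W u == x)%:R)%:E.

Definition mutually_independent (R : realType) (dO : measure_display)
    (Omega : measurableType dO) (P : probability Omega R) (I : choiceType)
    (G : I -> set (set Omega)) : Prop :=
  forall (J : {fset I}) (A : I -> set Omega),
    (forall i, i \in J -> G i (A i)) ->
    (P (\bigcap_(i in [set` J]) A i) = \prod_(i <- J) P (A i))%E.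

Definition sources_sigma_algebras (R : realType) (dO : measure_display)
    (Omega : measurableType dO) (P : probability Omega R) (d : nat)
    (N : vertex -> {RV P >-> nat}) (S : nat -> {RV P >-> (nat * nat)%type})
    (X : vertex -> {RV P >-> lattice d})
    (i : vertex + nat + vertex) : set (set Omega) :=
  match i with
  | inl (inl u) => g_sigma_algebra_preimage (N u)
  | inl (inr k) => g_sigma_algebra_preimage (S k)
  | inr u => g_sigma_algebra_preimage (X u)
  end.

(* Given the tree, the increments along its edges are i.i.d. with law theta
   because the field X is i.i.d. and independent of (N, S).  The field (N, S, X) is indexed by all labels; only the labels belonging to
   the tree matter.  In the law of S k, the number of children of c_{-k-1} is j
   with probability size_biased mu j, and given this c_{-k} is uniform. *)
Record is_Tinf_field (R : realType) (dO : measure_display)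
    (Omega : measurableType dO) (P : probability Omega R) (d : nat)
    (mu : probability nat R) (theta : probability (lattice d) R)
    (N : vertex -> {RV P >-> nat}) (S : nat -> {RV P >-> (nat * nat)%type})
    (X : vertex -> {RV P >-> lattice d}) : Prop := {
  offspring_law : forall u (A : set nat), P (N u @^-1` A) = mu A ;
  spine_law : forall k j i, P (S k @^-1` [set (j, i)]) =
    if (i < j)%N then (size_biased mu j * (j%:R^-1)%:E)%E else 0%E ;
  jump_law : forall u (A : set (lattice d)), P (X u @^-1` A) = theta A ;
  sources_independent :
    mutually_independent P (sources_sigma_algebras N S X) }.

Section RandomTree.
Context (R : realType) (dO : measure_display) (Omega : measurableType dO)
  (P : probability Omega R) (d : nat) (N : vertex -> {RV P >-> nat})
  (S : nat -> {RV P >-> (nat * nat)%type}) (X : vertex -> {RV P >-> lattice d}).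

Definition Tinf (omega : Omega) : set vertex :=
  tree (fun u => N u omega) (fun k => S k omega).

Definition Tplus (omega : Omega) : set vertex :=
  tree_future (fun u => N u omega) (fun k => S k omega).

Definition WTinf (omega : Omega) : vertex -> lattice d :=
  walk 0 (fun u => X u omega).

Definition Esc : set Omega :=
  [set omega | forall u, Tinf omega u -> u <> cursor -> WTinf omega u <> 0].

Definition Esc_plus : set Omega :=
  [set omega | forall u, Tplus omega u -> WTinf omega u <> 0].

End RandomTree.

(* Main.v *)
Require Import Defs.
From HB Require Import structures.
From mathcomp Require Import all_boot all_order all_algebra finmap.
From mathcomp Require Import all_classical all_reals all_analysis.
From mathcomp Require Import measurable_realfun ring lra.
Import Order.TTheory GRing.Theory Num.Theory.

Set Implicit Arguments.
Unset Strict Implicit.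
Unset Printing Implicit Defensive.

Local Open Scope ring_scope.

(** Cut the tree along its spine. The vertex [c_{-k-1}], the bushes grafted on
    it beside [c_{-k}] and the edge from it to [c_{-k}] form a block. The blocks
    are i.i.d., and what the blocks beyond the [n]-th do relatively to [c_{-n}]
    is independent of the first [n] blocks and has the law of the whole
    ([nu_later_blocks]). Criticality makes the bushes finite ([extinction]), so
    that a point is visited infinitely often if and only if infinitely many
    blocks visit it.

    Zero-one law. Let [p x] be the probability that infinitely many blocks visit
    [x]. Conditioning on the first block shows that [p] is a bounded harmonic
    function of the random walk with law [theta]; by the Choquet-Deny argument
    ([choquet_deny]) it is invariant under translation by the points charged by
    [theta], hence constant as these generate the lattice. The event is then
    independent of the first [n] blocks for every [n], thus of itself
    ([visits_io_01]). The same holds if one only looks at the vertices lying to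
    the right of the spine, or to its left, or on it.

    No escape implies recurrence. Let [g v] be the probability that no block
    visits [v]. If [theta] charges [y], then with positive probability [y] is the
    first increment along the spine while the other vertices of the first block
    keep away from [v] ([avoids_step]); hence if [g 0 = 0], then [g] vanishes at
    every position that [0] can take as seen from the spine, and whatever the
    first [n] blocks do, the later ones visit [0] almost surely. So there
    are infinitely many visits ([recurrent_of_avoids0]). As the escape
    probability is at least [mu 0 * g 0], it can vanish only in the recurrent
    case; if it is positive, then the zero-one law leaves finitely many visits.

    The future of the cursor contains all that lies to the right of the spine.
    In the recurrent case, by the zero-one law, one of the left side, the right
    side and the spine visits each point infinitely often. Exchanging left and
    right preserves the law ([nu_mirror]). And if the spine does so then,
    given the walk along the spine, the children placed just to the right of
    the spine each have the same positive chance to make a prescribed jump,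
    independently, so that infinitely many do ([prob_spine_le_right]). Hence
    the right side visits each point infinitely often ([recurrent_right]), and
    the probabilities of the two escape events vanish together. *)

(** * Countable combinations of events *)

Section MeasurablePredicates.
Local Open Scope classical_set_scope.
Context d0 (T0 : measurableType d0).

Lemma measurable_ex (T : countType) (A : T -> T0 -> Prop) :
  (forall t, measurable [set c | A t c]) ->
  measurable [set c | exists t, A t c].
Proof.
move=> mA; rewrite (_ : [set _ | _] =
    \bigcup_n (if choice.unpickle n is Some t then [set c | A t c] else set0)).
  by apply: bigcupT_measurable => n; case: choice.unpickle.
apply/seteqP; split=> [c [t At]|c [n _]] /=.
  by exists (choice.pickle t) => //; rewrite choice.pickleK.
by case: choice.unpickle => // t At; exists t.
Qed.

Lemma negligible_ex (R : realType) (m : {measure set T0 -> \bar R})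
    (T : countType) (F : T -> T0 -> Prop) :
  (forall t, m.-negligible [set c | F t c]) -> m.-negligible [set c | exists t, F t c].
Proof.
move=> mF; apply: (@negligibleS _ _ _ m (\bigcup_n
    (if choice.unpickle n is Some t then [set c | F t c] else set0))).
  by move=> c [t Ft]; exists (choice.pickle t) => //=; rewrite choice.pickleK.
apply: negligible_bigcup => n; case: (choice.unpickle n) => //.
exact: negligible_set0.
Qed.

Lemma measurable_notP (A : T0 -> Prop) :
  measurable [set c | A c] -> measurable [set c | ~ A c].
Proof. by move=> mA; exact: measurableC. Qed.

Lemma measurable_all (T : countType) (A : T -> T0 -> Prop) :
  (forall t, measurable [set c | A t c]) ->
  measurable [set c | forall t, A t c].
Proof.
move=> mA; rewrite (_ : [set _ | _] = [set c | ~ exists t, ~ A t c]).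
  apply: measurable_notP; apply: measurable_ex => t; exact: measurable_notP.
apply/seteqP; split=> c /=.
  by move=> h [t]; exact.
by move=> h t; apply: contrapT => nA; apply: h; exists t.
Qed.

Lemma measurable_andP (A B : T0 -> Prop) : measurable [set c | A c] ->
  measurable [set c | B c] -> measurable [set c | A c /\ B c].
Proof. by move=> mA mB; exact: measurableI. Qed.

Lemma measurable_orP (A B : T0 -> Prop) : measurable [set c | A c] ->
  measurable [set c | B c] -> measurable [set c | A c \/ B c].
Proof. by move=> mA mB; exact: measurableU. Qed.

Lemma measurable_impP (A B : T0 -> Prop) : measurable [set c | A c] ->
  measurable [set c | B c] -> measurable [set c | A c -> B c].
Proof.
move=> mA mB; rewrite (_ : [set _ | _] = [set c | ~ A c \/ B c]).
  by apply: measurable_orP => //; exact: measurable_notP.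
apply/seteqP; split=> c /=; last by move=> [nA /nA|].
by move=> AB; have [/AB|] := pselect (A c); [right|left].
Qed.

Lemma measurable_constP (p : Prop) : measurable [set _ : T0 | p].
Proof.
have [hp|hp] := pselect p.
  by rewrite (_ : [set _ | _] = setT)//; apply/seteqP; split.
by rewrite (_ : [set _ | _] = set0)//; apply/seteqP; split.
Qed.

(** All subsets of the target are allowed, so that events on a countable target
    can be given by arbitrary predicates. *)
Definition dmeas T (f : T0 -> T) := forall Q : set T, measurable (f @^-1` Q).

Lemma dmeas_comp T U (g : T -> U) (f : T0 -> T) :
  dmeas f -> dmeas (fun c => g (f c)).
Proof. by move=> mf Q; exact: (mf (g @^-1` Q)). Qed.

Lemma dmeas_pair (T U : countType) (f : T0 -> T) (g : T0 -> U) :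
  dmeas f -> dmeas g -> dmeas (fun c => (f c, g c)).
Proof.
move=> mf mg Q.
rewrite (_ : _ @^-1` _ = [set c | exists t, exists u,
    [/\ f c = t, g c = u & Q (t, u)]]).
  apply: measurable_ex => t; apply: measurable_ex => u.
  rewrite (_ : [set _ | _] = (f @^-1` [set t]) `&` (g @^-1` [set u]) `&`
     [set _ | Q (t, u)]).
    by apply: measurableI; [exact: measurableI|exact: measurable_constP].
  by apply/seteqP; split=> c /= [[]].
apply/seteqP; split=> c /=; last by move=> [t [u [-> ->]]].
by exists (f c), (g c).
Qed.

Lemma dmeas_cst T (t : T) : dmeas (fun=> t).
Proof. by move=> Q; exact: measurable_constP. Qed.

Lemma dmeas_op (T U W : countType) (h : T -> U -> W) f g :
  dmeas f -> dmeas g -> dmeas (fun c : T0 => h (f c) (g c)).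
Proof. by move=> mf mg; exact: (dmeas_comp (fun p => h p.1 p.2) (dmeas_pair mf mg)). Qed.

End MeasurablePredicates.

(** * Families of independent coordinates *)

Section Config.
Local Open Scope classical_set_scope.

Definition coord_events (I : eqType) (V : pointedType) : set (set (I -> V)) :=
  [set B | exists i (Q : set V), B = [set c | Q (c i)]].

Definition config (I : eqType) (V : pointedType) : Type :=
  g_sigma_algebraType (@coord_events I V).

HB.instance Definition _ (I : eqType) (V : pointedType) :=
  Measurable.on (config I V).

Context (R : realType) (I : eqType) (V : pointedType).
Local Notation C := (config I V).

Lemma dmeas_coord (i : I) : dmeas (fun c : C => c i).
Proof. by move=> Q; apply: sub_sigma_algebra; exists i, Q. Qed.

Definition rect (s : seq I) (a : I -> set V) : set C :=
  [set c | forall i, i \in s -> a i (c i)].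

Lemma measurable_rect s a : measurable (rect s a).
Proof.
elim: s => [|i s IH].
  by rewrite (_ : rect _ _ = setT)//; apply/seteqP; split.
rewrite (_ : rect _ _ = [set c | a i (c i)] `&` rect s a).
  by apply: measurableI => //; exact: (@dmeas_coord i (a i)).
apply/seteqP; split=> c /=.
  by move=> h; split; [|move=> j js]; apply: h; rewrite inE ?eqxx// js orbT.
by move=> [ai h] j; rewrite inE => /orP[/eqP ->//|]; exact: h.
Qed.

Lemma rect_undup s a : rect (undup s) a = rect s a.
Proof. by apply/seteqP; split=> c h i; move: (h i); rewrite mem_undup. Qed.

Lemma measurable_configE :
  measurable = <<s [set B | exists s a, B = rect s a] >> :> set (set C).
Proof.
apply/seteqP; split.
  apply: sub_smallest2r; first exact: smallest_sigma_algebra.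
  move=> _ [i [Q ->]]; exists [:: i], (fun=> Q).
  apply/seteqP; split=> c /=; first by move=> h j; rewrite inE => /eqP ->.
  by move=> /(_ i); apply; rewrite inE.
apply: smallest_sub; first exact: sigma_algebra_measurable.
by move=> _ [s [a ->]]; exact: measurable_rect.
Qed.

Lemma rect_setI_closed : setI_closed [set B | exists s a, B = rect s a].
Proof.
move=> _ _ [s [a ->]] [t [b ->]]; exists (s ++ t).
exists (fun i => [set v | (i \in s -> a i v) /\ (i \in t -> b i v)]).
apply/seteqP; split=> c /=.
  by move=> [hs ht] i _; split; [exact: hs|exact: ht].
move=> h; split=> i hi; have := h i; rewrite mem_cat hi ?orbT.
  by move=> /(_ erefl)[+ _]; exact.
by move=> /(_ erefl)[_]; exact.
Qed.

Lemma rect_measure_unique (m1 m2 : {measure set C -> \bar R}) :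
  (m1 setT < +oo)%E ->
  (forall s a, uniq s -> m1 (rect s a) = m2 (rect s a)) ->
  forall A : set C, measurable A -> m1 A = m2 A.
Proof.
move=> m1oo m12; apply: (measure_unique _ (fun=> setT) measurable_configE).
- exact: rect_setI_closed.
- by move=> _; exists [::], (fun=> setT); apply/seteqP; split.
- by apply/seteqP; split=> // x _; exists 0%N.
- by move=> _ [s [a ->]]; rewrite -rect_undup; apply: m12; exact: undup_uniq.
- by [].
Qed.

Context (nu : probability C R).
Hypothesis nu_indep : forall s a, uniq s ->
  nu (rect s a) = (\prod_(i <- s) nu [set c | a i (c i)])%E.

Lemma measurable_config_fun d0 (T0 : measurableType d0) (f : T0 -> C) :
  (forall i, dmeas (fun x => f x i)) -> measurable_fun setT f.
Proof.
move=> mf; apply: (@measurability _ _ _ _ setT f (@coord_events I V)) => //.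
by move=> _ [_ [i [Q ->]] <-]; rewrite setTI; exact: mf.
Qed.

(** Injectivity of [sigma] keeps the new coordinates independent, so that the
    two laws agree on rectangles. This serves to move along the spine, to pass
    to the subtree of a vertex, and to exchange left and right. *)
Lemma nu_relabel (sigma : I -> I) (f : I -> V -> V) : injective sigma ->
  (forall i (Q : set V), nu [set c | Q (f i (c (sigma i)))] = nu [set c | Q (c i)]) ->
  forall A : set C, measurable A ->
    nu [set c : C | A (fun i => f i (c (sigma i)))] = nu A.
Proof.
move=> sI fE A mA; pose T (c : C) : C := fun i => f i (c (sigma i)).
have mT : measurable_fun setT T.
  apply: measurable_config_fun => i; apply: (dmeas_comp (f i)).
  exact: dmeas_coord.
pose m := measure_function_pushforward__canonical__measure_function_Measure nu mT.
suff : m A = nu A by [].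
apply: rect_measure_unique => //.
  by rewrite /= /pushforward preimage_setT probability_setT ltry.
move=> s a us; pose b j := [set v | forall i, i \in s -> sigma i = j -> a i (f i v)].
have bE i (c : C) : i \in s -> b (sigma i) (c (sigma i)) = a i (f i (c (sigma i))).
  move=> si; apply/propext; split; first exact.
  by move=> h j sj /sI ->.
rewrite /= /pushforward (_ : T @^-1` _ = rect (map sigma s) b); last first.
  apply/seteqP; split=> c /= h.
    by move=> _ /mapP[i si ->]; rewrite bE//; exact: h.
  by move=> i si; rewrite -bE//; apply: h; exact: map_f.
rewrite nu_indep ?map_inj_uniq// nu_indep// big_map big_seq [RHS]big_seq.
apply: eq_bigr => i si; rewrite -(fE i (a i)); congr (nu _).
by apply/seteqP; split=> c /=; rewrite bE.
Qed.

Definition glue (J : pred I) (c c' : C) : C := fun i => if J i then c i else c' i.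

Lemma measurable_glue J : measurable_fun setT (fun p : C * C => glue J p.1 p.2).
Proof.
apply: measurable_config_fun => i Q; rewrite /glue; case: (J i).
  have : measurable_fun [set: C * C] fst by exact: measurable_fst.
  by move=> /(_ measurableT _ (dmeas_coord i Q)); rewrite setTI.
have : measurable_fun [set: C * C] snd by exact: measurable_snd.
by move=> /(_ measurableT _ (dmeas_coord i Q)); rewrite setTI.
Qed.

Lemma measurable_glue_section J (A : set C) (c : C) : measurable A ->
  measurable [set c' | A (glue J c c')].
Proof.
move=> mA; rewrite -[X in measurable X]setTI.
have : measurable_fun setT (glue J c).
  apply: measurable_config_fun => i; rewrite /glue; case: (J i).
    exact: dmeas_cst.
  exact: dmeas_coord.
by move=> /(_ measurableT _ mA).
Qed.

(** Fubini's theorem for an independent family: the image of [nu \x nu] under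
    [glue J] gives to rectangles the same mass as [nu]. Freezing the first
    argument amounts to conditioning on the coordinates in [J]. *)
Lemma nu_glue J (A : set C) : measurable A ->
  nu A = (\int[nu]_c nu [set c' | A (glue J c c')])%E.
Proof.
move=> mA.
pose m := measure_function_pushforward__canonical__measure_function_Measure
  (product_measure1 nu nu) (measurable_glue J).
transitivity (m A); last first.
  rewrite /= /pushforward; apply: eq_integral => c _ /=; congr (nu _).
  by apply/seteqP; split=> c'; rewrite /xsection /= ?inE.
apply: rect_measure_unique => //; first by rewrite /= probability_setT ltry.
move=> s a us; rewrite /= nu_indep// /pushforward.
rewrite (_ : _ @^-1` _ = rect [seq i <- s | J i] a `*` rect [seq i <- s | ~~ J i] a).
  rewrite product_measure1E; try exact: measurable_rect.
  by rewrite /= !nu_indep ?filter_uniq// !big_filter [LHS](bigID J).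
apply/seteqP; split=> -[c c'] /=.
  by move=> h; split=> i; rewrite mem_filter /= => /andP[Ji si]; have := h i si;
    rewrite /glue ?Ji ?(negbTE Ji).
move=> [h h'] i si; rewrite /glue; case: ifPn => Ji.
  by apply: h; rewrite mem_filter Ji.
by apply: h'; rewrite mem_filter /= Ji.
Qed.

Definition depends (J : pred I) (A : set C) :=
  forall c c', (forall i, J i -> c i = c' i) -> A c -> A c'.

Lemma nu_setI_glue J (A B : set C) : measurable A -> measurable B -> depends J B ->
  nu (B `&` A) = (\int[nu]_(c in B) nu [set c' | A (glue J c c')])%E.
Proof.
move=> mA mB dB; rewrite (nu_glue J (measurableI _ _ mB mA)).
rewrite [RHS]integral_mkcond; apply: eq_integral => c _.
rewrite patchE; case: ifPn => [|nBc].
  rewrite inE => Bc; congr (nu _); apply/seteqP; split=> c' /=; first by case.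
  by move=> ?; split=> //; apply: dB Bc => i Ji; rewrite /glue Ji.
rewrite (_ : [set _ | _] = set0) ?measure0//; apply/seteqP; split=> // c' /= [Bg _].
move/negP: nBc; apply; rewrite inE; apply: dB Bg => i Ji; by rewrite /glue Ji.
Qed.

Lemma nu_indepI J1 J2 (A B : set C) : measurable A -> measurable B ->
  depends J1 A -> depends J2 B -> (forall i, J1 i -> ~~ J2 i) ->
  nu (A `&` B) = (nu A * nu B)%E.
Proof.
move=> mA mB dA dB J12; rewrite (nu_setI_glue mB mA dA).
under eq_integral => c _.
  rewrite (_ : [set _ | _] = B); last first.
    by apply/seteqP; split=> c' /=; apply: dB => i J2i; rewrite /glue;
       case: ifPn => // /J12; rewrite J2i.
  over.
by rewrite integral_cst// muleC.
Qed.
End Config.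

(** * The tree and the walk as functions of the sources *)

Section Trees.
Implicit Types (N : vertex -> nat) (S : nat -> nat * nat) (u : vertex).

(** [subtree N k p w]: the word [w] labels a descendant of the vertex [(k, p)],
    all branching on the way being governed by [N]. *)
Fixpoint subtree N k (p w : seq nat) : bool :=
  if w is i :: w' then (i < N (k, p))%N && subtree N k (rcons p i) w' else true.

Definition in_treeb N S u : bool :=
  match u with
  | (0, w) => subtree N 0 [::] w
  | (_.+1, [::]) => true
  | (k.+1, i :: w) => [&& (i < (S k).1)%N, i != (S k).2 & subtree N k.+1 [:: i] w]
  end.

Lemma subtree_rcons N k p w i :
  subtree N k p (rcons w i) = subtree N k p w && (i < N (k, p ++ w))%N.
Proof.
elim: w p => [|j w IH] p /=; first by rewrite cats0 andbT.
by rewrite IH -andbA cat_rcons.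
Qed.

Lemma in_treebP N S u : reflect (tree N S u) (in_treeb N S u).
Proof.
apply: (iffP idP).
  case: u => k w; elim/last_ind: w => [|w i IH]; first by move=> _; exact: in_tree_spine.
  case: k IH => [|k] IH.
    rewrite /= subtree_rcons => /andP[/IH tw iN].
    have := in_tree_child tw (i := i); rewrite /= /nchildren; case: w tw iN {IH} => [|j w] tw iN; exact.
  case: w IH => [|j w] IH.
    move=> /= /and3P[iS ir _].
    have := @in_tree_child N S (k.+1, [::]) i (in_tree_spine _ _ _) iS.
    by rewrite /= (negbTE ir).
  rewrite rcons_cons /= subtree_rcons !andbA => /andP[tw iN].
  have /IH tw' : in_treeb N S (k.+1, j :: w) by rewrite /= -andbA in tw *.
  exact: (in_tree_child tw' (i := i)).
elim=> [[|k]//|{}u i _ IH].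
case: u IH => -[|k] [|j w] /=.
- by move=> _; rewrite andbT.
- by move=> /andP[-> tw] iN /=; rewrite subtree_rcons tw.
- by move=> _ iS; case: eqVneq => ir; [case: (k)|rewrite /= iS ir].
- by move=> /and3P[-> -> tw] iN /=; rewrite subtree_rcons tw.
Qed.

Lemma eq_subtree N N' k p k' p' w :
  (forall v, N (k, p ++ v) = N' (k', p' ++ v)) ->
  subtree N k p w = subtree N' k' p' w.
Proof.
elim: w p p' => //= i w IH p p' NN'.
rewrite -[p]cats0 -[p']cats0 NN' !cats0; congr (_ && _).
by apply: IH => v; rewrite !cat_rcons.
Qed.

End Trees.

Section Configurations.
Local Open Scope classical_set_scope.
Variable d : nat.

Definition idx : Type := (vertex + nat + vertex)%type.
HB.instance Definition _ := Countable.on idx.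
Definition iN (u : vertex) : idx := inl (inl u).
Definition iS (k : nat) : idx := inl (inr k).
Definition iX (u : vertex) : idx := inr u.

(** A single value type for the three kinds of sources makes the configurations
    a space of functions; each kind of source has its own component. *)
Definition val_type : Type := (nat * nat * lattice d)%type.
HB.instance Definition _ := Pointed.on val_type.
Local Notation C := (config idx val_type).
Implicit Types c : C.

Definition cN c (u : vertex) : nat := (c (iN u)).1.1.
Definition cS c (k : nat) : nat * nat := (c (iS k)).1.
Definition cX c (u : vertex) : lattice d := (c (iX u)).2.
Definition ctree c (u : vertex) : bool := in_treeb (cN c) (cS c) u.
Definition cwalk c (u : vertex) : lattice d := walk 0 (cX c) u.

(** Block [k.+1] gathers the sources of [c_{-k-1}], of the bushes grafted on it
    and of the edge from it to [c_{-k}], which is labelled by its lower end;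
    block [0] gathers those of [c_0] and of its descendants. *)
Definition blk (i : idx) : nat :=
  match i with
  | inl (inl (k, _)) => k
  | inl (inr k) => k.+1
  | inr (k, [::]) => k.+1
  | inr (k, _ :: _) => k
  end.

Definition shift_idx n (i : idx) : idx :=
  match i with
  | inl (inl (k, w)) => iN (k + n, w)
  | inl (inr k) => iS (k + n)
  | inr (k, w) => iX (k + n, w)
  end.

Lemma shift_idx_inj n : injective (shift_idx n).
Proof.
by move=> [[[k w]|k]|[k w]] [[[l v]|l]|[l v]] //= [] /addIn -> // ->.
Qed.

Lemma blk_shift n i : blk (shift_idx n i) = (blk i + n)%N.
Proof. by case: i => [[[k w]|k]|[k [|j w]]]. Qed.

Definition shift n c : C := fun i => c (shift_idx n i).

Definition agree (J : pred idx) c c' := forall i, J i -> c i = c' i.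

Lemma walkE c k w : cwalk c (k, w) =
  - (\sum_(0 <= j < k) cX c (j, [::])) + \sum_(1 <= l < (size w).+1) cX c (k, take l w).
Proof. by rewrite /cwalk /walk sub0r. Qed.

Lemma walk_spine c k : cwalk c (k, [::]) = - (\sum_(0 <= j < k) cX c (j, [::])).
Proof. by rewrite walkE [X in _ + X]big_geq ?addr0. Qed.

Lemma walk_shift n c k w :
  cwalk c ((k + n)%N, w) = cwalk c (n, [::]) + cwalk (shift n c) (k, w).
Proof.
rewrite walk_spine !walkE addrA; congr (_ + _).
rewrite -opprD; congr (- _).
rewrite (@big_cat_nat _ _ _ n 0 (k + n)) ?leq_addl//=; congr (_ + _).
by rewrite -{1}[n]add0n big_addn addnK.
Qed.

Lemma ctree_shift n c k w : ctree c ((k + n).+1, w) = ctree (shift n c) (k.+1, w).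
Proof.
have E i v : subtree (cN c) (k + n).+1 [:: i] v = subtree (cN (shift n c)) k.+1 [:: i] v.
  by apply: eq_subtree => v'.
by case: w => // i w; rewrite /ctree /in_treeb E.
Qed.

(** The words [w] are the labels of the vertices of block [k.+1]; a predicate
    [K] on the rank of the spine and on words selects one side of it. *)
Definition visits_block (K : nat * nat -> seq nat -> bool) (x : lattice d) c k :=
  exists w, [/\ ctree c (k.+1, w), K (cS c k) w & cwalk c (k.+1, w) = x].

(** Blocks are counted rather than vertices: this does not involve the size of
    the bushes, and is the same thing when they are finite. *)
Definition visits_io K x : set C :=
  [set c | forall n, exists k, (n <= k)%N /\ visits_block K x c k].

Lemma not_visits_io K x c : ~ visits_io K x c ->
  exists n, forall k, (n <= k)%N -> ~ visits_block K x c k.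
Proof.
move=> nio; apply: contrapT => h; apply: nio => n; apply: contrapT => h'; apply: h.
by exists n => k nk vk; apply: h'; exists k.
Qed.

Lemma visits_block_shift K x n c k :
  visits_block K x c (k + n) <->
  visits_block K (x - cwalk c (n, [::])) (shift n c) k.
Proof.
split=> -[w [tw Kw Ww]]; exists w; split.
- by rewrite -ctree_shift.
- by [].
- by rewrite -Ww -addSn walk_shift addrAC subrr add0r.
- by rewrite ctree_shift.
- by [].
- by rewrite -addSn walk_shift Ww addrCA subrr addr0.
Qed.

(** Dropping the first [n] blocks moves the cursor to [c_{-n}] and forgets only
    finitely many blocks. *)
Lemma visits_io_shift K x n c :
  visits_io K x c <-> visits_io K (x - cwalk c (n, [::])) (shift n c).
Proof.
split=> h m.
  have [k [mk /= vk]] := h (m + n)%N; exists (k - n)%N; split.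
    by rewrite -(leq_add2r n) subnK//; exact: leq_trans (leq_addl _ _) mk.
  apply/visits_block_shift; rewrite subnK//; exact: leq_trans (leq_addl _ _) mk.
have [k [mk /= vk]] := h m; exists (k + n)%N; split.
  exact: leq_trans mk (leq_addr _ _).
exact/visits_block_shift.
Qed.

Lemma cwalk_spine_depends n c c' : agree (fun i => blk i <= n)%N c c' ->
  cwalk c (n, [::]) = cwalk c' (n, [::]).
Proof.
move=> cc'; rewrite !walk_spine; congr (- _); apply: eq_big_nat => j /andP[_ jn].
by rewrite /cX cc'.
Qed.

Lemma visits_block_depends K x c c' k :
  agree (fun i => 0 < blk i <= k.+1)%N c c' ->
  visits_block K x c k -> visits_block K x c' k.
Proof.
move=> cc' [w [tw Kw Ww]]; have SS : cS c k = cS c' k by rewrite /cS cc' //= leqnn.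
exists w; split; last 2 first.
- by rewrite -SS.
- rewrite -Ww !walkE; congr (- _ + _).
    by apply: eq_big_nat => j /andP[_ jk]; rewrite /cX cc' //=.
  apply: eq_big_nat => l /andP[l0 lw]; rewrite /cX cc' //=.
  by case: (w) lw => [|a v]; case: l l0 => //= l _ _; rewrite leqnn.
move: tw; rewrite /ctree; case: (w) => //= i v.
rewrite SS (_ : subtree (cN c) _ _ _ = subtree (cN c') k.+1 [:: i] v)//.
by apply: eq_subtree => v'; rewrite /cN cc' //= leqnn.
Qed.

Lemma visits_io_depends K x c c' : agree (fun i => 0 < blk i)%N c c' ->
  visits_io K x c -> visits_io K x c'.
Proof.
move=> cc' h n; have [k [nk vk]] := h n; exists k; split=> //.
by apply: visits_block_depends vk => i /andP[+ _]; exact: cc'.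
Qed.

Lemma dmeas_cN u : dmeas (fun c => cN c u).
Proof. apply: (dmeas_comp (fun v : val_type => v.1.1)); exact: dmeas_coord. Qed.

Lemma dmeas_cS k : dmeas (fun c => cS c k).
Proof. apply: (dmeas_comp (fun v : val_type => v.1)); exact: dmeas_coord. Qed.

Lemma dmeas_cX u : dmeas (fun c => cX c u).
Proof. apply: (dmeas_comp (fun v : val_type => v.2)); exact: dmeas_coord. Qed.

Lemma dmeas_subtree k p w : dmeas (fun c => subtree (cN c) k p w).
Proof.
elim: w p => [|i w IH] p /=; first exact: dmeas_cst.
apply: dmeas_op => //; apply: (dmeas_comp (fun n => i < n)%N); exact: dmeas_cN.
Qed.

Lemma dmeas_ctree u : dmeas (fun c => ctree c u).
Proof.
case: u => -[|k] [|i w]; rewrite /ctree /=; try exact: dmeas_cst.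
  exact: (dmeas_subtree 0 [::] (i :: w)).
apply: dmeas_op; first by apply: (dmeas_comp (fun s => i < s.1)%N); exact: dmeas_cS.
apply: dmeas_op; last exact: dmeas_subtree.
by apply: (dmeas_comp (fun s => i != s.2)); exact: dmeas_cS.
Qed.

Lemma dmeas_sum (T : Type) (s : seq T) (F : T -> C -> lattice d) :
  (forall t, dmeas (F t)) -> dmeas (fun c => \sum_(t <- s) F t c).
Proof.
move=> mF; elim: s => [|t s IH].
  by rewrite (_ : (fun _ => _) = fun=> 0); [exact: dmeas_cst|apply/funext => c; rewrite big_nil].
rewrite (_ : (fun _ => _) = (fun c => F t c + \sum_(t <- s) F t c)).
  exact: (dmeas_op (fun a b : lattice d => a + b)).
by apply/funext => c; rewrite big_cons.
Qed.

Lemma dmeas_cwalk u : dmeas (fun c => cwalk c u).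
Proof.
case: u => k w; rewrite (_ : (fun _ => _) = fun c : C =>
  - (\sum_(0 <= j < k) cX c (j, [::])) + \sum_(1 <= l < (size w).+1) cX c (k, take l w)).
  2: by apply/funext => c; rewrite walkE.
apply: (dmeas_op (fun a b : lattice d => - a + b)); apply: dmeas_sum => t; exact: dmeas_cX.
Qed.

Lemma measurable_visits_block K x k : measurable [set c | visits_block K x c k].
Proof.
apply: measurable_ex => w.
rewrite (_ : [set _ | _] = [set c | ctree c (k.+1, w)] `&` [set c | K (cS c k) w]
   `&` [set c | cwalk c (k.+1, w) = x]); last first.
  by apply/seteqP; split=> c /= => [[]|[[]]].
apply: measurableI; last exact: (dmeas_cwalk _ [set x]).
apply: measurableI; first exact: (dmeas_ctree _ [set b | b]).
exact: (dmeas_cS k [set s | K s w]).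
Qed.

Lemma measurable_visits_io K x : measurable (visits_io K x).
Proof.
apply: measurable_all => n; apply: measurable_ex => k; apply: measurable_andP.
  exact: measurable_constP.
exact: measurable_visits_block.
Qed.
End Configurations.

(** * Bounded harmonic functions *)

Section ChoquetDeny.
Variables (R : realType) (V : zmodType) (q : V -> R) (t : R) (y : V).
Hypothesis q01 : forall x, 0 <= q x <= 1.
Hypothesis t01 : 0 < t <= 1.
Hypothesis q_max : forall z (M : R), 0 <= M -> (forall x, q (x + z) - q x <= M) ->
  forall x, q (x + z) - q x <= t * (q (x + z + y) - q (x + y)) + (1 - t) * M.

(** [q_max] is what harmonicity gives for the increments of [q]. If [M], the
    supremum of [q (x + y) - q x], were positive, a value close enough to [M] at
    [x] would force values at least [M / 2] at [x + y], [x + 2 y], and so on;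
    as these increments telescope, [q] would leave the unit interval. *)
Lemma harmonic_incr x : q (x + y) <= q x.
Proof.
have [/andP[t0 t1]] := (t01, t01).
pose h x := q (x + y) - q x.
suff : h x <= 0 by rewrite /h subr_le0.
pose H : set R := range h; pose M := sup H.
have hub x' : h x' <= 1.
  have /andP[_ ?] := q01 (x' + y); have /andP[? _] := q01 x'.
  by rewrite lerBlDr -[leLHS]addr0 lerD.
have supH : has_sup H.
  by split; [exists (h 0), 0|exists 1 => _ [x' _ <-]].
have hM x' : h x' <= M by apply: ub_le_sup; [exact: supH.2|exists x'].
case: (leP (h x) 0) => // hx0; exfalso.
have M0 : 0 < M by exact: lt_le_trans hx0 (hM x).
have step x' : M - h (x' + y) <= (M - h x') / t.
  rewrite ler_pdivlMr//.
  have := q_max (ltW M0) hM x'; rewrite -/(h x').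
  rewrite (addrAC x' y y) -/(h (x' + y)) => hx'.
  have -> : (M - h (x' + y)) * t = M - (t * h (x' + y) + (1 - t) * M).
    by ring.
  exact: lerB.
(* [k] increments of size [M / 2] add up to more than [1]; the distance to [M]
   is at most divided by [t] at each step, so a distance of [M / 2 * t ^+ k]
   at the start remains below [M / 2] for [k] steps. *)
pose k := (Num.truncn (2 / M)).+1.
have kM : 2 < k%:R * M.
  by rewrite -ltr_pdivrMr//; exact: truncnS_gt.
have [_ [x0 _ <-] hx0'] : exists2 r, H r & M - M / 2 * t ^+ k < r.
  by apply: sup_adherent => //; rewrite mulr_gt0 ?divr_gt0 ?exprn_gt0.
have iterh i : (i <= k)%N -> M / 2 <= h (x0 + y *+ i).
  move=> ik; have : M - h (x0 + y *+ i) <= (M - h x0) / t ^+ i.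
    elim: i {ik} => [|i IH]; first by rewrite mulr0n addr0 expr0 divr1.
    have -> : (M - h x0) / t ^+ i.+1 = (M - h x0) / t ^+ i / t.
      by rewrite exprSr invfM mulrA.
    rewrite mulrSr addrA (le_trans (step _))//.
    by rewrite ler_pM2r ?invr_gt0.
  move=> hi; have hi' : (M - h x0) / t ^+ i <= M / 2.
    rewrite ler_pdivrMr ?exprn_gt0//; apply: (@le_trans _ _ (M / 2 * t ^+ k)).
      by rewrite lerBlDr -lerBlDl ltW.
    by rewrite ler_pM2l ?divr_gt0// ler_wiXn2l// ?ltW.
  have := le_trans hi hi'; rewrite lerBlDr -lerBlDl; apply: le_trans.
  by rewrite {2}(splitr M) addrK.
have tel m : q (x0 + y *+ m) - q x0 = \sum_(i < m) h (x0 + y *+ i).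
  elim: m => [|m IH]; first by rewrite mulr0n addr0 subrr big_ord0.
  by rewrite big_ord_recr /= -IH /h mulrSr addrA [RHS]addrC addrA subrK.
have : q (x0 + y *+ k) - q x0 <= 1.
  have /andP[_ ?] := q01 (x0 + y *+ k); have /andP[? _] := q01 x0.
  by rewrite lerBlDr -[leLHS]addr0 lerD.
rewrite tel => le1; suff : 1 < \sum_(i < k) h (x0 + y *+ i) by rewrite ltNge le1.
apply: (@lt_le_trans _ _ (\sum_(i < k) (M / 2))).
  by rewrite sumr_const card_ord -[_ *+ k]mulr_natl; lra.
by apply: ler_sum => i _; apply: iterh; exact: ltnW.
Qed.
End ChoquetDeny.

(** Both inequalities come from [harmonic_incr], applied to [q] and to [1 - q]. *)
Lemma choquet_deny (R : realType) (V : zmodType) (q : V -> R) (t : R) (y : V) :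
  (forall x, 0 <= q x <= 1) -> 0 < t <= 1 ->
  (forall z (M : R), 0 <= M -> (forall x, q (x + z) - q x <= M) ->
   forall x, q (x + z) - q x <= t * (q (x + z + y) - q (x + y)) + (1 - t) * M) ->
  forall x, q (x + y) = q x.
Proof.
move=> q01 t01 qm x; apply/eqP; rewrite eq_le (harmonic_incr q01 t01 qm)/=.
rewrite -(lerN2 (q (x + y))) -(lerD2l 1).
apply: (@harmonic_incr _ _ (fun x => 1 - q x) t y) => //.
  by move=> x'; have /andP[? ?] := q01 x'; apply/andP; split; lra.
move=> z M M0 hM x'.
have E a b : (1 - q a) - (1 - q b) = q b - q a.
  by lra.
rewrite !E; have := qm (- z) M M0 _ (x' + z); rewrite addrK.
apply=> a; have := hM (a - z); by rewrite /= E addrNK.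
Qed.

(** * The law of the sources *)

Section TreeLaw.
Local Open Scope classical_set_scope.
Variables (R : realType) (d : nat).
Local Notation C := (config idx (val_type d)).

(** In [law_S] the size-biased weight [j * mu j] is divided by the [j] possible
    ranks; hence [mu j]. *)
Record tree_law (mu : probability nat R) (theta : probability (lattice d) R)
    (nu : probability C R) : Prop := TreeLaw {
  law_indep : forall s a, uniq s ->
    nu (rect s a) = (\prod_(i <- s) nu [set c | a i (c i)])%E ;
  law_N : forall u (Q : set (val_type d)),
    nu [set c | Q (c (iN u))] = mu [set n | Q (n, 0%N, 0)] ;
  law_S : forall k j i, nu [set c | cS c k = (j, i)] =
    (if (i < j)%N then mu [set j] else 0)%E ;
  law_S_val : forall k (Q : set (val_type d)),
    nu [set c | Q (c (iS k))] = nu [set c | Q (cS c k, 0)] ;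
  law_X : forall u (Q : set (val_type d)),
    nu [set c | Q (c (iX u))] = theta [set x | Q (0%N, 0%N, x)] }.

Variables (mu : probability nat R) (theta : probability (lattice d) R).
Variable nu : probability C R.
Hypothesis lawP : tree_law mu theta nu.


Lemma nu_slices (T : countType) (h : C -> T) (Q : set T) : dmeas h ->
  nu [set c | Q (h c)] =
  (\sum_(n <oo) nu [set c : C | choice.pickle (h c) = n /\ Q (h c)])%E.
Proof.
move=> mh; have mF n : measurable [set c : C | choice.pickle (h c) = n /\ Q (h c)].
  exact: (mh [set s | choice.pickle s = n /\ Q s]).
rewrite (_ : [set c | Q (h c)] =
    \bigcup_n [set c : C | choice.pickle (h c) = n /\ Q (h c)]).
  apply: measure_semi_bigcup => //; last exact: bigcupT_measurable.
  by move=> m n _ _ [c /= [[<- _] [<- _]]].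
apply/seteqP; split=> [c Qc|c [n _ []]//].
by exists (choice.pickle (h c)).
Qed.

Lemma nu_countable (T : countType) (f g : C -> T) (Q : set T) :
  dmeas f -> dmeas g ->
  (forall t, nu [set c | f c = t] = nu [set c | g c = t]) ->
  nu [set c | Q (f c)] = nu [set c | Q (g c)].
Proof.
move=> mf mg fg; rewrite (nu_slices Q mf) (nu_slices Q mg).
apply: eq_eseriesr => n _.
have [[t [<- Qt]]|nt] := pselect (exists t : T, choice.pickle t = n /\ Q t).
  have E h : [set c : C | choice.pickle (h c) = choice.pickle t /\ Q (h c)] =
             [set c | h c = t].
    apply/seteqP; split=> c /=; last by move=> ->.
    by move=> [/(pcan_inj choice.pickleK)].
  by rewrite !E.
have E h : [set c : C | choice.pickle (h c) = n /\ Q (h c)] = set0.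
  by apply/seteqP; split=> // c [/= hn ?]; apply: nt; exists (h c).
by rewrite !E.
Qed.

Lemma nu_countable0 (T : countType) (f : C -> T) (Q : set T) : dmeas f ->
  (forall t, Q t -> nu [set c | f c = t] = 0%E) -> nu [set c | Q (f c)] = 0%E.
Proof.
move=> mf Q0; rewrite (nu_slices Q mf); apply: eseries0 => n _ _.
have [[t [<- Qt]]|nt] := pselect (exists t : T, choice.pickle t = n /\ Q t).
  rewrite (_ : [set c | _] = [set c | f c = t]) ?Q0//.
  apply/seteqP; split=> c /=; last by move=> ->.
  by move=> [/(pcan_inj choice.pickleK)].
rewrite (_ : [set c | _] = set0) ?measure0//.
by apply/seteqP; split=> // c [/= hn ?]; apply: nt; exists (f c).
Qed.

Lemma theta_countable0 (Q : set (lattice d)) :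
  (forall x, Q x -> theta [set x] = 0%E) -> theta Q = 0%E.
Proof.
move=> Q0; rewrite -[LHS](law_X lawP cursor (fun v => Q v.2)).
apply: (nu_countable0 (dmeas_cX cursor)) => x Qx.
by rewrite -(Q0 _ Qx); exact: (law_X lawP cursor (fun v => v.2 = x)).
Qed.

Lemma nu_S_eq k l (Q : set (nat * nat)) :
  nu [set c | Q (cS c k)] = nu [set c | Q (cS c l)].
Proof.
apply: nu_countable; [exact: dmeas_cS|exact: dmeas_cS|move=> [j i]].
by rewrite !(law_S lawP).
Qed.

Lemma nu_coord_shift n i (Q : set (val_type d)) :
  nu [set c | Q (c (shift_idx n i))] = nu [set c | Q (c i)].
Proof.
case: i => [[[k w]|k]|[k w]] /=.
- by rewrite !(law_N lawP).
- rewrite !(law_S_val lawP); exact: (nu_S_eq _ _ (fun s => Q (s, 0))).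
- by rewrite !(law_X lawP).
Qed.

Lemma nu_shift n (A : set C) : measurable A -> nu [set c : C | A (shift n c)] = nu A.
Proof.
move=> mA; apply: (nu_relabel (law_indep lawP) (f := fun _ v => v)) => //.
  exact: shift_idx_inj.
by move=> i Q; exact: nu_coord_shift.
Qed.

Lemma dmeas_measurable (T : Type) (f : C -> T) (h : T -> \bar R) :
  dmeas f -> measurable_fun [set: C] (h \o f).
Proof. by move=> mf _ Y mY; rewrite setTI comp_preimage; exact: mf. Qed.

(** Conditionally on the first [n] blocks the later ones, seen from [c_{-n}],
    have the law of the whole: they involve other sources, with the same laws. *)
Lemma nu_later_blocks n (E : lattice d -> set C) (B : set C) :
  measurable B -> depends (fun i => blk i <= n)%N B ->
  (forall x, measurable (E x)) -> (forall x, depends (fun i => 0 < blk i)%N (E x)) ->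
  forall x : lattice d, measurable [set c | E (x - cwalk c (n, [::])) (shift n c)] ->
  nu (B `&` [set c | E (x - cwalk c (n, [::])) (shift n c)]) =
  (\int[nu]_(c in B) nu (E (x - cwalk c (n, [::]))%R))%E.
Proof.
move=> mB dB mE dE x mEx; rewrite (nu_setI_glue (law_indep lawP) mEx mB dB).
apply: eq_integral => c _; rewrite -[RHS](nu_shift n)//; congr (nu _).
set J := fun i => (blk i <= n)%N.
have Wg c' : cwalk (glue J c c') (n, [::]) = cwalk c (n, [::]).
  by apply: cwalk_spine_depends => i; rewrite /glue /J => ->.
have ag c' i : (0 < blk i)%N -> shift n (glue J c c') i = shift n c' i.
  move=> i0; rewrite /shift /glue /J blk_shift ifF//; apply/negbTE.
  by rewrite -ltnNge -{1}[n]add0n ltn_add2r.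
apply/seteqP; split=> c' /=; rewrite Wg; apply: dE => i i0; by rewrite ag.
Qed.
End TreeLaw.

(** * The zero-one law *)

Section Probability.
Local Open Scope classical_set_scope.
Context (R : realType) d0 (T0 : measurableType d0) (nu : probability T0 R).
Implicit Types A : set T0.

Definition prob A : R := fine (nu A).

Lemma probE A : measurable A -> nu A = (prob A)%:E.
Proof. by move=> mA; rewrite /prob fineK// fin_num_measure. Qed.

Lemma prob_ge0 A : 0 <= prob A.
Proof. by rewrite /prob fine_ge0. Qed.

Lemma prob_le1 A : measurable A -> prob A <= 1.
Proof. by move=> mA; rewrite -lee_fin -probE//; exact: probability_le1. Qed.

Lemma prob1P A : measurable A -> prob A = 1 <-> nu (~` A) = 0%E.
Proof.
move=> mA; rewrite probability_setC// probE// -EFinB.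
by split=> [->|[] /eqP]; rewrite ?subrr// subr_eq0 => /eqP.
Qed.

End Probability.

Section ZeroOne.
Local Open Scope classical_set_scope.
Variables (R : realType) (d : nat).
Local Notation C := (config idx (val_type d)).
Variables (mu : probability nat R) (theta : probability (lattice d) R).
Variable nu : probability C R.
Hypothesis lawP : tree_law mu theta nu.
Variable K : nat * nat -> seq nat -> bool.

Lemma nu_setI_visits_io n x (B : set C) : measurable B ->
  depends (fun i => blk i <= n)%N B ->
  nu (B `&` visits_io K x) =
  (\int[nu]_(c in B) nu (visits_io K (x - cwalk c (n, [::])%R)%R))%E.
Proof.
move=> mB dB.
have eA : visits_io K x =
   [set c | visits_io K (x - cwalk c (n, [::])) (shift n c)].
  by rewrite predeqE => c; exact: visits_io_shift.
rewrite [in LHS]eA; apply: (nu_later_blocks lawP) => //.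
- by move=> z; exact: measurable_visits_io.
- by move=> z c c' cc'; exact: visits_io_depends.
- by rewrite -eA; exact: measurable_visits_io.
Qed.

Lemma cwalk_spine1 c : cwalk c (1%N, [::]) = - cX c (0%N, [::]) :> lattice d.
Proof. by rewrite walk_spine big_nat1. Qed.

Lemma measurable_X0 (Q : set (lattice d)) : measurable [set c : C | Q (cX c (0%N, [::]))].
Proof. exact: (dmeas_cX _ Q). Qed.

Lemma depends_X0 (Q : set (lattice d)) :
  depends (fun i => blk i <= 1)%N [set c : C | Q (cX c (0%N, [::]))].
Proof. by move=> c c' cc' /=; rewrite /cX (cc' (iX (0%N, [::]))). Qed.

(** The part of the mean value property at [x] that is due to the first
    increments other than [y]. *)
Definition other_first_jumps y x := 
  (\int[nu]_(c in [set c : C | cX c (0%N, [::]) <> y]) nu (visits_io K (x + cX c (0%N, [::]))%R))%E.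

Lemma nu_X0 y : nu [set c : C | cX c (0%N, [::]) = y] = theta [set y].
Proof. exact: (law_X lawP _ (fun v => v.2 = y)). Qed.

(** The mean value property, with the increment [y] singled out. The edge from
    [c_{-1}] to [c_0] is climbed, so that seen from [c_{-1}] the target [x]
    becomes [x + y]. *)
Lemma visits_io_step x y : nu (visits_io K x) =
  (theta [set y] * nu (visits_io K (x + y)%R) + other_first_jumps y x)%E.
Proof.
have mV := measurable_visits_io K x.
rewrite -(setIT (visits_io K x)).
rewrite (_ : setT = [set c : C | cX c (0%N, [::]) = y] `|` [set c : C | cX c (0%N, [::]) <> y]).
  rewrite setIUr measureU; first last.
  - by apply/seteqP; split=> // c [[_ /= <-] []].
  - apply: measurableI => //; exact: (measurable_X0 (fun a => a <> y)).
  - apply: measurableI => //; exact: (measurable_X0 (fun a => a = y)).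
  rewrite /= !(setIC (visits_io K x)) (nu_setI_visits_io (n := 1)); last 2 first.
  - exact: (measurable_X0 (fun a => a = y)).
  - exact: (depends_X0 (Q := fun a => a = y)).
  rewrite (nu_setI_visits_io (n := 1)); last 2 first.
  - exact: (measurable_X0 (fun a => a <> y)).
  - exact: (depends_X0 (Q := fun a => a <> y)).
  congr (_ + _)%E.
    rewrite (eq_integral (cst (nu (visits_io K (x + y)%R)))).
      rewrite integral_cst//; last exact: (measurable_X0 (fun a => a = y)).
      by rewrite muleC -nu_X0.
    by move=> c; rewrite inE /= => <-; rewrite cwalk_spine1 opprK.
  by apply: eq_integral => c _; rewrite cwalk_spine1 opprK.
apply/seteqP; split=> // c _ /=; exact: EM.
Qed.

Lemma other_first_jumps_le y z (M : R) : 0 <= M ->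
  (forall x, prob nu (visits_io K (x + z)) - prob nu (visits_io K x) <= M) ->
  forall x, (other_first_jumps y (x + z) <= other_first_jumps y x + (M * (1 - fine (theta [set y])))%:E)%E.
Proof.
move=> M0 hM x; pose B := [set c : C | cX c (0%N, [::]) <> y].
have mB : measurable B by exact: (measurable_X0 (fun a => a <> y)).
have mf x' : measurable_fun B (fun c => nu (visits_io K (x' + cX c (0%N, [::]))%R)).
  apply: measurable_funTS.
  apply: (dmeas_measurable (fun a => nu (visits_io K (x' + a)%R))).
  exact: dmeas_cX.
have nB : nu B = (1 - fine (theta [set y]))%:E.
  have -> : B = ~` [set c : C | cX c (0%N, [::]) = y] by [].
  rewrite probability_setC; last exact: (measurable_X0 (fun a => a = y)).
  by rewrite nu_X0 EFinB fineK// fin_num_measure.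
rewrite EFinM -nB -integral_cst// -ge0_integralD//.
rewrite /other_first_jumps -/B; apply: ge0_le_integral => //.
  by apply: emeasurable_funD => //; exact: (mf x).
move=> c _; have := hM (x + cX c (0%N, [::])).
rewrite -lee_fin EFinB -!probE; try exact: measurable_visits_io.
rewrite leeBlDr; last by rewrite fin_num_measure//; exact: measurable_visits_io.
by rewrite [X in nu (visits_io K X)]addrAC addeC.
Qed.

Lemma visits_io_invariant y : theta [set y] <> 0%E ->
  forall x, prob nu (visits_io K (x + y)) = prob nu (visits_io K x).
Proof.
move=> ty; have tfin : theta [set y] \is a fin_num by rewrite fin_num_measure.
apply: (@choquet_deny _ _ (fun x => prob nu (visits_io K x)) (fine (theta [set y]))).
- by move=> x; rewrite prob_ge0 prob_le1//; exact: measurable_visits_io.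
- rewrite lt_neqAle fine_ge0// andbT; apply/andP; split.
    apply/eqP => t0; apply: ty.
    by rewrite -(fineK tfin) -t0.
  by rewrite -lee_fin fineK// probability_le1.
move=> z M M0 hM x.
have mV a := measurable_visits_io K a.
have rfin x' : other_first_jumps y x' \is a fin_num.
  have : (other_first_jumps y x' <= nu (visits_io K x'))%E.
    by rewrite (visits_io_step x' y) leeDr// mule_ge0.
  move=> /le_lt_trans; rewrite ge0_fin_numE; last exact: integral_ge0.
  by apply; rewrite ltey_eq fin_num_measure.
have E x' : prob nu (visits_io K x') =
    fine (theta [set y]) * prob nu (visits_io K (x' + y)) + fine (other_first_jumps y x').
  by rewrite {1}/prob (visits_io_step x' y) fineD ?fineM// ?fin_numM// fin_num_measure.
have := other_first_jumps_le y M0 hM x.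
rewrite -(fineK (rfin _)) -(fineK (rfin x)) -EFinD lee_fin => h.
rewrite (E (x + z)) (E x); lra.
Qed.

Hypothesis theta_gen : not_supported_by_strict_subgroup theta.

(** The periods form a subgroup which [theta] charges fully. *)
Lemma visits_io_const x : prob nu (visits_io K x) = prob nu (visits_io K 0).
Proof.
pose H : set (lattice d) :=
  [set z | forall x, prob nu (visits_io K (x + z)) = prob nu (visits_io K x)].
suff HT : H = setT.
  have Hx : H x by rewrite HT.
  by have := Hx 0; rewrite add0r.
apply: theta_gen.
  split=> [x'|a b Ha Hb x']; first by rewrite addr0.
  by rewrite -(Hb (x' + (a - b))) -addrA subrK Ha.
apply/eqP; rewrite eq_le probability_le1//= -(probability_setT theta) -(setUv H).
rewrite measureU//; last by rewrite setICr.
rewrite -[leRHS]adde0 leeD2l//.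
rewrite measure_le0; apply/eqP; apply: (theta_countable0 lawP) => a Ha.
by apply: contrapT => /(@visits_io_invariant a).
Qed.

(** The probability does not depend on the target, hence conditioning on finitely
    many blocks does not change it: the event is independent of every event
    depending on finitely many sources, hence of itself. *)
Lemma visits_io_01 x : prob nu (visits_io K x) = 0 \/ prob nu (visits_io K x) = 1.
Proof.
have mA := measurable_visits_io K x.
set p := prob nu (visits_io K x).
have pE a : nu (visits_io K a) = p%:E.
  by rewrite probE ?(visits_io_const a) -?(visits_io_const x)//; exact: measurable_visits_io.
(* Finite measures agreeing on rectangles agree everywhere; evaluating them at
   the event itself gives [p = p * p]. *)
pose m1 := mrestr nu mA; pose m2 := mscale (NngNum (prob_ge0 nu (visits_io K x))) nu.
have m12 A : measurable A -> m1 A = m2 A.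
  apply: rect_measure_unique.
    by rewrite /m1 /= /mrestr setTI pE ltry.
  move=> s a _; rewrite /m1 /m2 /= /mrestr /mscale /=.
  rewrite (nu_setI_visits_io (n := \max_(i <- s) blk i)).
  - under eq_integral do rewrite pE.
    by rewrite integral_cst//; exact: measurable_rect.
  - exact: measurable_rect.
  - move=> c c' cc' /= h i si; rewrite -cc'; first exact: h.
    exact: leq_bigmax_seq.
have := m12 _ mA; rewrite /m1 /m2 /= /mrestr /mscale /= setIid pE -EFinM => -[].
move=> /eqP; rewrite -{1}[p]mulr1 -subr_eq0 -mulrBr mulf_eq0 subr_eq0.
by move=> /orP[/eqP|/eqP]; [left|right].
Qed.

End ZeroOne.

(** * Without escape, infinitely many visits *)

Section Escape.
Local Open Scope classical_set_scope.
Variables (R : realType) (d : nat).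
Local Notation C := (config idx (val_type d)).
Variables (mu : probability nat R) (theta : probability (lattice d) R).
Variable nu : probability C R.
Hypothesis lawP : tree_law mu theta nu.

Definition all_words : nat * nat -> seq nat -> bool := fun _ _ => true.

Definition avoids (x : lattice d) : set C :=
  [set c | forall k, ~ visits_block all_words x c k].

Lemma measurable_avoids x : measurable (avoids x).
Proof.
apply: measurable_all => k; apply: measurable_notP.
exact: measurable_visits_block.
Qed.

Lemma depends_avoids x : depends (fun i => 0 < blk i)%N (avoids x).
Proof.
move=> c c' cc' h k vk; apply: (h k); apply: visits_block_depends vk => i /andP[i0 _].
by rewrite cc'.
Qed.

Lemma avoids_later n x : [set c | avoids (x - cwalk c (n, [::])) (shift n c)] =
  [set c | forall k, (n <= k)%N -> ~ visits_block all_words x c k].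
Proof.
rewrite predeqE => c; split=> h k.
  by move=> nk /=; rewrite -(subnK nk) => /visits_block_shift; exact: h.
by move=> /= /visits_block_shift; apply: h; rewrite leq_addl.
Qed.

Lemma measurable_avoids_later n x :
  measurable [set c | avoids (x - cwalk c (n, [::])) (shift n c)].
Proof.
rewrite avoids_later; apply: measurable_all => k; apply: measurable_impP.
  exact: measurable_constP.
apply: measurable_notP; exact: measurable_visits_block.
Qed.

Lemma nu_avoids_later n x (B : set C) : measurable B ->
  depends (fun i => blk i <= n)%N B ->
  nu (B `&` [set c | avoids (x - cwalk c (n, [::])) (shift n c)]) =
  (\int[nu]_(c in B) nu (avoids (x - cwalk c (n, [::]))%R))%E.
Proof.
move=> mB dB; apply: (nu_later_blocks lawP) => //.
- exact: measurable_avoids.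
- exact: depends_avoids.
- exact: measurable_avoids_later.
Qed.

Lemma nu_rect_neq0 (s : seq idx) (a : idx -> set (val_type d)) :
  (forall i, i \in s -> nu [set c | a i (c i)] <> 0%E) -> nu (rect s a) <> 0%E.
Proof.
move=> a0; rewrite -rect_undup (law_indep lawP) ?undup_uniq//.
rewrite big_seq; elim/big_ind: _ => //.
- by apply/eqP; rewrite onee_neq0.
- by move=> x y x0 y0 /eqP; rewrite mule_eq0 => /orP[] /eqP.
- by move=> i; rewrite mem_undup; exact: a0.
Qed.

Variable j0 : nat.
Hypothesis j0_gt1 : (1 < j0)%N.
Hypothesis mu_j0 : mu [set j0] <> 0%E.
Hypothesis mu_0 : mu [set 0%N] <> 0%E.
Hypothesis theta_supp : forall z : lattice d, z <> 0 ->
  exists2 y, theta [set y] <> 0%E & y <> z.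

(** With positive probability the first spine increment is [y], [c_{-1}] has
    [j0] children, the first of which is [c_0], and the others have no child and
    make a jump [y'] which does not lead to [v]. The first block then avoids
    [v], and it remains for the later blocks to avoid [v + y], as seen from
    [c_{-1}]. *)
Lemma avoids_step v y : nu (avoids v) = 0%E -> theta [set y] <> 0%E ->
  v + y <> 0 -> nu (avoids (v + y)) = 0%E.
Proof.
move=> gv ty vy; have [y' ty' y'vy] := theta_supp vy.
pose a (i : idx) : set (val_type d) := match i with
  | inl (inl _) => [set v | v.1.1 = 0%N]
  | inl (inr _) => [set v | v.1 = (j0, 0%N)]
  | inr (_, [::]) => [set v | v.2 = y]
  | inr (_, _ :: _) => [set v | v.2 = y'] end.
pose s := iX (0%N, [::]) :: iS 0 :: [seq iN (1%N, [:: i]) | i <- iota 0 j0] ++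
  [seq iX (1%N, [:: i]) | i <- iota 0 j0].
have nB : nu (rect s a) <> 0%E.
  apply: nu_rect_neq0 => -[[u|k]|[k [|i w]]] _ /=.
  - by rewrite (law_N lawP u (fun v => v.1.1 = 0%N)).
  - by rewrite -/(cS _ _) (law_S lawP) (ltn_trans _ j0_gt1).
  - by rewrite (law_X lawP _ (fun v => v.2 = y)).
  - by rewrite (law_X lawP _ (fun v => v.2 = y')).
have mB := measurable_rect s a.
have dB : depends (fun i => blk i <= 1)%N (rect s a).
  move=> c c' cc' /= h i si; rewrite -cc'; first exact: h.
  move: si; rewrite !inE mem_cat => /orP[/eqP->//|/orP[/eqP->//|/orP[]]];
    by move=> /mapP[k _ ->].
have inB c : rect s a c -> [/\ cX c (0%N, [::]) = y, cS c 0 = (j0, 0%N),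
    forall i, (i < j0)%N -> cN c (1%N, [:: i]) = 0%N &
    forall i, (i < j0)%N -> cX c (1%N, [:: i]) = y'].
  move=> h; split.
  - by apply: (h (iX (0%N, [::]))); rewrite !inE eqxx.
  - by apply: (h (iS 0)); rewrite !inE eqxx.
  - move=> i ij; apply: (h (iN (1%N, [:: i]))).
    by rewrite !inE mem_cat (map_f (fun i => iN (1%N, [:: i]))) ?orbT// mem_iota.
  - move=> i ij; apply: (h (iX (1%N, [:: i]))).
    by rewrite !inE mem_cat (map_f (fun i => iX (1%N, [:: i]))) ?orbT// mem_iota.
have := nu_avoids_later v mB dB.
rewrite (eq_integral (cst (nu (avoids (v + y)%R)))); last first.
  by move=> c; rewrite inE => /inB[cy _ _ _]; rewrite cwalk_spine1 cy opprK.
rewrite integral_cst// [X in X = _](_ : _ = 0%E); last first.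
  apply/eqP; rewrite -measure_le0 -gv; apply: le_measure.
  - by rewrite inE; apply: measurableI => //; exact: measurable_avoids_later.
  - by rewrite inE; exact: measurable_avoids.
  rewrite avoids_later => c [/inB[cy cS0 cN0 cX0] h] [|k]; last exact: h.
  move=> [w [tw _ Ww]]; move: tw Ww; case: w => [|i w].
    rewrite cwalk_spine1 cy => _ yv; apply: vy; rewrite -yv.
    by rewrite addNr.
  rewrite /ctree /= cS0 => /and3P[ij _]; case: w => [|i' w]; last first.
    by rewrite /= cN0.
  move=> _; rewrite walkE /= big_nat1 big_nat1 /= cy cX0// => yv.
  by apply: y'vy; rewrite -yv addrAC addNr add0r.
by move=> /esym/eqP; rewrite mule_eq0 => /orP[/eqP//|/eqP].
Qed.

(** Almost surely the spine only makes steps charged by [theta]. Along such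
    steps [avoids_step] propagates the hypothesis, which takes over again each
    time the spine is back at [0]. *)
Lemma avoids_spine_null : nu (avoids 0) = 0%E -> forall n,
  nu [set c : C | nu (avoids (0 - cwalk c (n, [::]))) <> 0%E] = 0%E.
Proof.
move=> g0 n.
apply: measure_negligible.
  apply: (dmeas_cwalk _ [set w | nu (avoids (0 - w)) <> 0%E]).
apply: (@negligibleS _ _ _ nu (\bigcup_k [set c : C | theta [set cX c (k, [::])] = 0%E])).
  move=> c /= h; apply: contrapT => nk; apply: h.
  have {}nk k : theta [set cX c (k, [::])] <> 0%E by move=> tk; apply: nk; exists k.
  elim: n => [|n IH]; first by rewrite walk_spine big_geq// oppr0 subr0.
  have -> : 0 - cwalk c (n.+1, [::]) = 0 - cwalk c (n, [::]) + cX c (n, [::]).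
    by rewrite !walk_spine big_nat_recr//= !sub0r !opprK.
  have [->//|/eqP h0] := eqVneq (0 - cwalk c (n, [::]) + cX c (n, [::])) 0.
  exact: avoids_step.
apply: negligible_bigcup => k.
exists [set c : C | theta [set cX c (k, [::])] = 0%E]; split=> //.
  exact: (dmeas_cX _ [set x | theta [set x] = 0%E]).
apply: etrans (law_X lawP (k, [::]) (fun v => theta [set v.2] = 0%E)) _.
exact: (theta_countable0 lawP).
Qed.

Lemma recurrent_of_avoids0 : nu (avoids 0) = 0%E -> prob nu (visits_io all_words 0) = 1.
Proof.
move=> g0.
have n0 : nu (~` (visits_io all_words (0 : lattice d))) = 0%E.
  apply: measure_negligible.
    by apply: measurableC; exact: measurable_visits_io.
  apply: (@negligibleS _ _ _ nu (\bigcup_n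
      [set c | avoids (0 - cwalk c (n, [::])) (shift n c)])).
    move=> c /= /not_visits_io[n nv]; exists n => //.
    by rewrite avoids_later.
  apply: negligible_bigcup => n.
  exists [set c | avoids (0 - cwalk c (n, [::])) (shift n c)]; split=> //.
    exact: measurable_avoids_later.
  pose B := [set c : C | nu (avoids (0 - cwalk c (n, [::]))) = 0%E].
  have mB : measurable B.
    exact: (dmeas_cwalk _ [set w | nu (avoids (0 - w)) = 0%E]).
  rewrite -(setIT [set c | avoids _ _]) -(setUv B) setIUr.
  apply/eqP; rewrite -measure_le0; apply: (le_trans (measureU2 _ _ _)).
  - by apply: measurableI => //; exact: measurable_avoids_later.
  - by apply: measurableI; [exact: measurable_avoids_later|exact: measurableC].
  rewrite [X in nu X + _]setIC /= nu_avoids_later//; last first.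
    by move=> c c' cc'; rewrite /B /= (cwalk_spine_depends cc').
  rewrite (eq_integral (cst 0%E)); last by move=> c; rewrite inE.
  rewrite integral_cst// mul0e add0e -[leRHS](avoids_spine_null g0 n).
  apply: le_measure; rewrite ?inE.
  - by apply: measurableI; [exact: measurable_avoids_later|exact: measurableC].
  - exact: (dmeas_cwalk _ [set w | nu (avoids (0 - w)) <> 0%E]).
  - by move=> c [].
by apply/prob1P => //; exact: measurable_visits_io.
Qed.

Definition escapes : set C :=
  [set c | forall u, ctree c u -> u <> cursor -> cwalk c u <> 0].

Lemma measurable_escapes : measurable escapes.
Proof.
apply: measurable_all => u; apply: measurable_impP.
  exact: (dmeas_ctree _ [set b | b]).
apply: measurable_impP; first exact: measurable_constP.
exact: (dmeas_cwalk _ [set w | w <> 0]).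
Qed.

(** If the cursor has no child and no block visits [0], then the walk escapes;
    these two events are independent. *)
Lemma avoids0_of_escapes : nu escapes = 0%E -> nu (avoids 0) = 0%E.
Proof.
move=> e0; have mN : measurable [set c : C | cN c cursor = 0%N].
  exact: (dmeas_cN _ [set n | n = 0%N]).
have me := measurable_escapes.
have : nu ([set c : C | cN c cursor = 0%N] `&` avoids 0) = 0%E.
  apply/eqP; rewrite -measure_le0 -e0; apply: le_measure; rewrite ?inE//.
    by apply: measurableI => //; exact: measurable_avoids.
  move=> c [/= cN0 av] [[|k] w] tu uc Wu.
    case: w tu uc Wu => [//|i w]; rewrite /ctree /=.
    by rewrite -/cursor cN0.
  by apply: (av k); exists w.
rewrite (nu_indepI (law_indep lawP) mN (measurable_avoids 0)
    (J1 := fun i => blk i == 0%N) _ (depends_avoids (x := 0))).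
- move=> /eqP; rewrite mule_eq0 => /orP[/eqP|/eqP//].
  by rewrite (law_N lawP _ (fun v => v.1.1 = 0%N)).
- by move=> c c' cc' /=; rewrite /cN cc'.
- by move=> i /eqP ->.
Qed.

Lemma escapes_not_io : escapes `&` visits_io all_words 0 = set0.
Proof.
apply/seteqP; split=> // c [ec /(_ 0%N)[k [_ [w [tw _ Ww]]]]].
exact: (ec _ tw).
Qed.
End Escape.

(** * Finiteness of the bushes *)

Section Extinction.
Local Open Scope classical_set_scope.
Variables (R : realType) (d : nat).
Local Notation C := (config idx (val_type d)).
Variables (mu : probability nat R) (theta : probability (lattice d) R).
Variable nu : probability C R.
Hypothesis lawP : tree_law mu theta nu.

Definition reaches n k p : set C :=
  [set c | exists w, size w = n /\ subtree (cN c) k p w].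

Lemma measurable_reaches n k p : measurable (reaches n k p).
Proof.
apply: measurable_ex => w; apply: measurable_andP; first exact: measurable_constP.
exact: (dmeas_subtree _ _ _ [set b | b]).
Qed.

(** Only the descendants of [(0, [::])] matter; adding [k] to the spine index of
    all the labels makes the map injective. *)
Definition subtree_idx k p (i : idx) : idx :=
  if i is inl (inl (m, v)) then iN ((k + m)%N, p ++ v) else i.

Lemma subtree_idx_inj k p : injective (subtree_idx k p).
Proof.
move=> [[[m v]|m]|[m v]] [[[m' v']|m']|[m' v']] //= [] /addnI <- pv.
by congr (inl (inl (_, _))); apply/eqP; move/eqP: pv; rewrite eqseq_cat// => /andP[].
Qed.

Lemma nu_reaches n k p : nu (reaches n k p) = nu (reaches n 0 [::]).
Proof.
rewrite -[RHS](nu_relabel (law_indep lawP) (f := fun _ v => v) (subtree_idx_inj (k := k) (p := p)));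
  last exact: measurable_reaches; last first.
  by move=> [[[m v]|m]|[m v]] Q //=; rewrite !(law_N lawP).
congr (nu _); rewrite predeqE => c.
have E w : subtree (cN (fun i => c (subtree_idx k p i))) 0 [::] w = subtree (cN c) k p w.
  by apply: eq_subtree => v; rewrite /cN /= addn0.
by split=> -[w [sw tw]]; exists w; split=> //; [rewrite E|rewrite -E].
Qed.

Lemma reaches_depends n k p :
  depends (fun i => if i is inl (inl (m, v)) then (m == k) && prefix p v else false)
    (reaches n k p).
Proof.
move=> c c' cc' [w [sw tw]]; exists w; split=> //.
suff <- : subtree (cN c) k p w = subtree (cN c') k p w by [].
apply: eq_subtree => v.
by rewrite /cN cc' //= eqxx prefix_prefix.
Qed.

Definition some_child_reaches n m : set C :=
  [set c | exists i, (i < m)%N /\ reaches n 0 [:: i] c].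

Lemma measurable_some_child_reaches n m : measurable (some_child_reaches n m).
Proof.
apply: measurable_ex => i; apply: measurable_andP; first exact: measurable_constP.
exact: measurable_reaches.
Qed.

Lemma some_child_reaches_depends n m :
  depends (fun i => if i is inl (inl (0, _ :: _)) then true else false)
   (some_child_reaches n m).
Proof.
move=> c c' cc' [i [im ri]]; exists i; split=> //.
apply: reaches_depends ri => -[[[[|//] [|i' v]]|//]|//]//= _; exact: cc'.
Qed.

Lemma reachesS n : reaches n.+1 0 [::] =
  [set c | some_child_reaches n (cN c (0%N, [::])) c].
Proof.
rewrite predeqE => c; split.
  by move=> [[|i w] [//= [sw]]] /andP[iN tw]; exists i; split=> //; exists w.
by move=> [i [iN [w [sw tw]]]]; exists (i :: w); rewrite /= sw iN.
Qed.

Local Notation a n := (prob nu (reaches n 0 [::])).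
Local Notation u n m := (prob nu (some_child_reaches n m)).

Lemma prob_reaches n k p : prob nu (reaches n k p) = a n.
Proof. by rewrite /prob nu_reaches. Qed.

Lemma some_child_reachesS n m :
  some_child_reaches n m.+1 = some_child_reaches n m `|` reaches n 0 [:: m].
Proof.
rewrite predeqE => c; split=> [[i []]|[[i [im ri]]|rm]].
- rewrite ltnS leq_eqVlt => /orP[/eqP ->|im] ri; [by right|by left; exists i].
- by exists i; split=> //; rewrite ltnS ltnW.
- by exists m.
Qed.

Lemma prob_some_child_reachesS n m : u n m.+1 <= u n m + a n.
Proof.
rewrite some_child_reachesS -lee_fin EFinD -(prob_reaches n 0 [:: m]) -!probE.
- apply: measureU2; [exact: measurable_some_child_reaches|exact: measurable_reaches].
- exact: measurable_reaches.
- exact: measurable_some_child_reaches.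
- by apply: measurableU; [exact: measurable_some_child_reaches|exact: measurable_reaches].
Qed.

Lemma prob_some_child_reaches_le n m : u n m <= m%:R * a n.
Proof.
elim: m => [|m IH].
  rewrite mul0r (_ : some_child_reaches _ _ = set0) /prob ?measure0//.
  by apply/seteqP; split=> // c [i []].
apply: (le_trans (prob_some_child_reachesS _ _)).
by rewrite mulrS mulrDl mul1r addrC lerD2l.
Qed.

(** Two children being independent, the union bound can be improved. *)
Lemma prob_some_child_reaches_le2 n m : (1 < m)%N -> u n m + a n ^+ 2 <= m%:R * a n.
Proof.
elim: m => // -[//|[_ _|m IH _]]; last first.
  have := IH isT; have := prob_some_child_reachesS n m.+2; rewrite -[m.+3%:R]natr1; lra.
pose A := reaches n 0 [:: 0%N]; pose B := reaches n 0 [:: 1%N].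
have mA : measurable A by exact: measurable_reaches.
have mB : measurable B by exact: measurable_reaches.
have -> : some_child_reaches n 2 = A `|` (B `\` A).
  rewrite !some_child_reachesS (_ : some_child_reaches n 0 = set0) ?set0U.
    rewrite predeqE => c; split=> [[Ac|Bc]|[Ac|[Bc _]]]; [by left| |by left|by right].
    by have [Ac|nAc] := pselect (A c); [left|right].
  by apply/seteqP; split=> // c [i []].
have AB : nu (B `&` A) = (nu B * nu A)%E.
  apply: (nu_indepI (law_indep lawP) mB mA (@reaches_depends _ _ _) (@reaches_depends _ _ _)).
  by move=> [[[k [|[|[|j]] v]]|//]|//]//=; rewrite ?andbF //= andbF.
have mD : measurable (B `\` A) by exact: measurableD.
have -> : prob nu (A `|` (B `\` A)) = a n + (a n - a n ^+ 2).
  apply: EFin_inj; rewrite -probE; last exact: measurableU.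
  rewrite measureU//; last by apply/seteqP; split=> // c [Ac []].
  rewrite measureD//; last by rewrite ltey_eq fin_num_measure.
  by rewrite /= AB !nu_reaches expr2 EFinD EFinB EFinM probE//; exact: measurable_reaches.
lra.
Qed.

Lemma nu_reachesS n : nu (reaches n.+1 0 [::]) =
  (\sum_(k <oo) mu [set k] * (u n k)%:E)%E.
Proof.
have mF k : measurable [set c : C | cN c (0%N, [::]) = k].
  exact: (dmeas_cN _ [set m | m = k]).
rewrite reachesS (_ : [set c | _] = \bigcup_k
    ([set c : C | cN c (0%N, [::]) = k] `&` some_child_reaches n k)).
  rewrite measure_semi_bigcup.
  - apply: eq_eseriesr => k _.
    rewrite /= (nu_indepI (law_indep lawP) (J1 := pred1 (iN (0%N, [::])))
      (mF k) (measurable_some_child_reaches n k) _ (@some_child_reaches_depends n k)).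
    + rewrite -probE; last exact: measurable_some_child_reaches.
      by rewrite (law_N lawP _ (fun v => v.1.1 = k)).
    + by move=> c c' cc' /=; rewrite /cN cc' //= .
    + by move=> i /eqP ->.
  - by move=> k; apply: measurableI => //; exact: measurable_some_child_reaches.
  - by move=> k l _ _ [c [[/= <- _] [<- _]]].
  - by apply: bigcupT_measurable => k; apply: measurableI => //; exact: measurable_some_child_reaches.
rewrite predeqE => c; split=> [h|[k _ [/= <-]]//].
by exists (cN c (0%N, [::])).
Qed.

Hypothesis mean1 : (\sum_(0 <= k <oo) (k%:R%:E * mu [set k]) = 1)%E.
Variable j0 : nat.
Hypothesis j0_gt1 : (1 < j0)%N.
Hypothesis mu_j0 : mu [set j0] <> 0%E.

(** By criticality the union bound on the children only gives that the
    probability to reach height [n] is nonincreasing; the gain for [j0]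
    children makes it decrease at least quadratically. *)
Lemma reaches_decay n : a n.+1 + fine (mu [set j0]) * a n ^+ 2 <= a n.
Proof.
have muf k : mu [set k] = (fine (mu [set k]))%:E by rewrite fineK// fin_num_measure.
have mu0 k : 0 <= fine (mu [set k]) by rewrite fine_ge0.
rewrite -lee_fin EFinD -[(a n.+1)%:E]probE; last exact: measurable_reaches.
have -> : (a n)%:E = (\sum_(0 <= k <oo) ((a n)%:E * (k%:R%:E * mu [set k])))%E.
  by rewrite nneseriesZl ?mean1 ?mule1// => k _; rewrite mule_ge0 ?lee_fin.
rewrite nu_reachesS (nneseriesD1 (n := j0))//; last first.
  by move=> k _; rewrite mule_ge0// lee_fin prob_ge0.
rewrite [leRHS](nneseriesD1 (n := j0))//; last first.
  by move=> k _; rewrite !mule_ge0// lee_fin// prob_ge0.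
rewrite addeAC; apply: leeD.
  rewrite (muf j0) -!EFinM -EFinD lee_fin.
  have := ler_wpM2l (mu0 j0) (prob_some_child_reaches_le2 n j0_gt1).
  lra.
apply: lee_nneseries => k; first by move=> _ _; rewrite mule_ge0// lee_fin prob_ge0.
move=> _; rewrite (muf k) -!EFinM lee_fin.
have := ler_wpM2l (mu0 k) (prob_some_child_reaches_le n k); lra.
Qed.

(** A sequence of numbers in the unit interval that remains above [e > 0] cannot
    lose at least a fixed multiple of [e ^+ 2] at each step. *)
Lemma extinction k p : nu [set c | forall n, reaches n k p c] = 0%E.
Proof.
set E := [set c | _].
have mE : measurable E by apply: measurable_all => n; exact: measurable_reaches.
have Ea n : prob nu E <= a n.
  rewrite -(prob_reaches n k p) -lee_fin -!probE//; last exact: measurable_reaches.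
  by apply: le_measure; rewrite ?inE//; first exact: measurable_reaches.
rewrite probE//; congr (_%:E); apply/eqP; rewrite eq_le prob_ge0 andbT.
case: (leP (prob nu E) 0) => // E0; exfalso.
set e := prob nu E in Ea E0; set m := fine (mu [set j0]).
have m0 : 0 < m.
  rewrite lt_neqAle fine_ge0// andbT; apply/eqP => m0; apply: mu_j0.
  by rewrite -[LHS]fineK ?fin_num_measure// -/m -m0.
have an n : a n <= 1 - n%:R * (m * e ^+ 2).
  elim: n => [|n IH]; first by rewrite mul0r subr0 prob_le1//; exact: measurable_reaches.
  have := reaches_decay n; rewrite -/m.
  have : m * e ^+ 2 <= m * a n ^+ 2.
    by rewrite ler_pM2l// lerXn2r ?nnegrE ?prob_ge0// ltW.
  rewrite -natr1; move: IH; lra.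
have me : 0 < m * e ^+ 2 by rewrite mulr_gt0// exprn_gt0.
have := an (Num.truncn (1 / (m * e ^+ 2))).+1.
have := Ea (Num.truncn (1 / (m * e ^+ 2))).+1.
have := truncnS_gt (1 / (m * e ^+ 2)); rewrite ltr_pdivrMr//.
lra.
Qed.

(** Finite branching: bounded height means finiteness. *)
Lemma finite_subtree (c : C) k p n : ~ reaches n k p c ->
  finite_set [set w | subtree (cN c) k p w].
Proof.
move=> nr; apply: (@sub_finite_set _ _ [set w | subtree (cN c) k p w /\ (size w < n)%N]).
  move=> w tw; split=> //; rewrite ltnNge; apply/negP => nw; apply: nr.
  exists (take n w); split; first by rewrite size_takel.
  move: tw; rewrite -{1}(cat_take_drop n w) /=.
  elim: (take n w) p {nw} => //= i v IH p /andP[-> tv]; exact: (IH _ tv).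
elim: n p {nr} => [|n IH] p.
  by rewrite (_ : [set _ | _] = set0)//; apply/seteqP; split=> // w [].
apply: (@sub_finite_set _ _ ([set [::]] `|` \bigcup_(i in `I_(cN c (k, p)))
  (cons i @` [set w | subtree (cN c) k (rcons p i) w /\ (size w < n)%N]))).
  move=> [|i w] /= [tw sw]; [by left|right].
  by move/andP: tw => [iN tw]; exists i => //; exists w.
rewrite finite_setU; split; first exact: finite_set1.
apply: bigcup_finite; first exact: finite_II.
by move=> i _; apply: finite_image; exact: IH.
Qed.

Lemma ae_finite_bushes :
  nu.-negligible [set c | ~ forall k p, finite_set [set w | subtree (cN c) k p w]].
Proof.
apply: (@negligibleS _ _ _ nu [set c | exists k, exists p, forall n, reaches n k p c]).
  move=> c /= nfin; apply: contrapT => h; apply: nfin => k p.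
  apply: contrapT => nf; apply: h; exists k, p => n; apply: contrapT => nr.
  by apply: nf; exact: finite_subtree nr.
apply: negligible_ex => k; apply: negligible_ex => p.
exists [set c | forall n, reaches n k p c]; split=> //; last exact: extinction.
by apply: measurable_all => n; exact: measurable_reaches.
Qed.

Lemma finite_visits (c : C) x :
  (forall k p, finite_set [set w | subtree (cN c) k p w]) ->
  ~ visits_io all_words x c -> finite_set [set u | ctree c u /\ cwalk c u = x].
Proof.
move=> fin /not_visits_io[n nv].
apply: (@sub_finite_set _ _ (\bigcup_(k in `I_n.+1) (pair k @` [set w | ctree c (k, w)]))).
  move=> [k w] /= [tw Ww]; exists k; last by exists w.
  case: k tw Ww => // k tw Ww; rewrite /= ltnS ltnNge; apply/negP => nk.
  by apply: (nv k nk); exists w.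
apply: bigcup_finite; first exact: finite_II.
move=> k _; apply: finite_image; case: k => [|k]; first exact: fin.
apply: (@sub_finite_set _ _ ([set [::]] `|` \bigcup_(i in `I_(cS c k).1)
  (cons i @` [set w | subtree (cN c) k.+1 [:: i] w]))).
  move=> [|i w] /= tw; [by left|right].
  by move/and3P: tw => [iN _ tw]; exists i => //; exists w.
rewrite finite_setU; split; first exact: finite_set1.
apply: bigcup_finite; first exact: finite_II.
by move=> i _; apply: finite_image; exact: fin.
Qed.
End Extinction.

(** * The right side of the spine *)

Section RightSide.
Local Open Scope classical_set_scope.
Variables (R : realType) (d : nat).
Local Notation C := (config idx (val_type d)).
Variables (mu : probability nat R) (theta : probability (lattice d) R).
Variable nu : probability C R.
Hypothesis lawP : tree_law mu theta nu.

Definition right_words (s : nat * nat) (w : seq nat) : bool :=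
  if w is i :: _ then (s.2 < i)%N else false.
(** The bound [s.2 < s.1], which holds almost surely, makes [visits_mirror] true
    on all configurations. *)
Definition left_words (s : nat * nat) (w : seq nat) : bool :=
  if w is i :: _ then (i < s.2 < s.1)%N else false.
Definition spine_words (_ : nat * nat) (w : seq nat) : bool := w == [::].

(** The pairs whose second component is not a rank have probability zero; they
    are fixed so as to get an involution. *)
Definition mirror_pair (s : nat * nat) : nat * nat :=
  if (s.2 < s.1)%N then (s.1, s.1.-1 - s.2)%N else s.

Lemma mirror_pairK : involutive mirror_pair.
Proof.
move=> [j i]; rewrite /mirror_pair; case: (ltnP i j) => [ij|ji] /=; last by rewrite ltnNge ji.
case: j ij => // j ij; rewrite /= ltnS leq_subr; congr (_, _).
by rewrite subKn.
Qed.

(** Reversing the order of the children of the spine vertices exchanges the two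
    sides; the subtrees of these children are moved as they are. *)
Definition mirror_word (s : nat * nat) (w : seq nat) : seq nat :=
  if w is i :: v then (if (i < s.1)%N then (s.1.-1 - i)%N else i) :: v else [::].

Lemma mirror_wordK s : involutive (mirror_word s).
Proof.
move=> [|i w] //=; case: (ltnP i s.1) => [ij|ji]; last by rewrite ltnNge ji.
case: s.1 ij => // j ij; rewrite /= ltnS leq_subr; congr (_ :: _).
by rewrite subKn.
Qed.

Definition mirror_idx (S : nat -> nat * nat) (i : idx) : idx :=
  match i with
  | inl (inl (k.+1, w)) => iN (k.+1, mirror_word (S k) w)
  | inr (k.+1, w) => iX (k.+1, mirror_word (S k) w)
  | _ => i
  end.

Lemma mirror_idxK S : involutive (mirror_idx S).
Proof. by move=> [[[[|k] w]|k]|[[|k] w]] //=; rewrite mirror_wordK. Qed.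

Definition mirror_val (i : idx) (v : val_type d) : val_type d :=
  if i is inl (inr _) then (mirror_pair v.1, v.2) else v.

Definition is_spine_source (i : idx) : bool := if i is inl (inr _) then true else false.

Definition mirror (c : C) : C := fun i => mirror_val i (c (mirror_idx (cS c) i)).

Lemma cS_mirror c k : cS (mirror c) k = mirror_pair (cS c k).
Proof. by []. Qed.

Lemma measurable_mirror : measurable_fun [set: C] mirror.
Proof.
apply: measurable_config_fun => i; apply: (dmeas_comp (mirror_val i)).
have mid : dmeas (fun c : C => c i) by exact: dmeas_coord.
case: i mid => [[[[|k] w]|k]|[[|k] w]] mid //= Q.
  rewrite (_ : _ @^-1` _ = [set c : C | exists w', mirror_word (cS c k) w = w' /\ Q (c (iN (k.+1, w')))]).
    apply: measurable_ex => w'; apply: measurable_andP.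
      exact: (dmeas_cS k [set s | mirror_word s w = w']).
    exact: (dmeas_coord (iN (k.+1, w')) Q).
  by rewrite predeqE => c; split=> [Qc|[_ [<-]]//]; eexists.
rewrite (_ : _ @^-1` _ = [set c : C | exists w', mirror_word (cS c k) w = w' /\ Q (c (iX (k.+1, w')))]).
  apply: measurable_ex => w'; apply: measurable_andP.
    exact: (dmeas_cS k [set s | mirror_word s w = w']).
  exact: (dmeas_coord (iX (k.+1, w')) Q).
by rewrite predeqE => c; split=> [Qc|[_ [<-]]//]; eexists.
Qed.

(** Given the numbers of children and the ranks along the spine, the mirror only
    permutes the other sources, which are i.i.d. of each kind; and the rank is
    uniform, so that reversing it does not change its law. *)
Lemma nu_mirror (A : set C) : measurable A -> nu [set c | A (mirror c)] = nu A.
Proof.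
move=> mA; pose J := is_spine_source.
have mmA : measurable [set c | A (mirror c)].
  by rewrite -[X in measurable X]setTI; exact: measurable_mirror.
(* [m] mirrors the ranks and leaves the other sources in place. *)
pose m (c : C) : C := fun i => mirror_val i (c i).
have mm : measurable_fun [set: C] m.
  apply: measurable_config_fun => i; apply: (dmeas_comp (mirror_val i)).
  exact: dmeas_coord.
have <- : nu [set c | A (m c)] = nu A.
  apply: (nu_relabel (law_indep lawP) (sigma := id)) => // -[[u|k]|u] Q //=.
  rewrite (law_S_val lawP k (fun v => Q (mirror_pair v.1, v.2))) (law_S_val lawP k Q).
  have mS : dmeas (fun c : C => mirror_pair (cS c k)).
    apply: (dmeas_comp mirror_pair); exact: dmeas_cS.
  apply: (nu_countable (fun s => Q (s, 0)) mS (@dmeas_cS d k)).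
  move=> [j i]; rewrite (law_S lawP).
  rewrite (_ : [set c | _] = [set c : C | cS c k = mirror_pair (j, i)]); last first.
    by rewrite predeqE => c; split=> /= [<-|->]; rewrite mirror_pairK.
  rewrite /mirror_pair /=; case: (ltnP i j) => [ij|ji]; last first.
    by rewrite (law_S lawP) ltnNge ji.
  rewrite (law_S lawP); case: (j) ij => // j' _.
  by rewrite ltnS leq_subr.
rewrite [LHS](nu_glue (law_indep lawP) J mmA).
have mAm : measurable [set c | A (m c)].
  by rewrite -[X in measurable X]setTI; exact: mm.
rewrite [RHS](nu_glue (law_indep lawP) J mAm).
apply: eq_integral => c _.
rewrite -[RHS](nu_relabel (law_indep lawP) (f := fun _ v => v)
  (inv_inj (mirror_idxK (cS c)))).
- congr (nu _); apply/funext => c' /=; congr (A _); apply/funext.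
  by move=> [[[[|k] w]|k]|[[|k] w]].
- by move=> [[[[|k] w]|k]|[[|k] w]] Q //=; rewrite ?(law_N lawP) ?(law_X lawP).
- exact: measurable_glue_section.
Qed.

Lemma cwalk_mirror c k w :
  cwalk (mirror c) (k.+1, w) = cwalk c (k.+1, mirror_word (cS c k) w).
Proof.
rewrite !walkE; congr (- _ + _).
  by apply: eq_bigr => -[|j] _.
have -> : size (mirror_word (cS c k) w) = size w by case: w.
apply: eq_big_nat => l /andP[l0 _]; rewrite /cX /mirror /=; congr (c (iX (_, _))).2.
by case: w => // i w; case: l l0.
Qed.

Lemma visits_mirror x c k :
  visits_block left_words x (mirror c) k -> visits_block right_words x c k.
Proof.
move=> [[|i w] [tw Kw Ww]] //; rewrite cS_mirror /left_words in Kw.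
have [rj /andP[ir _]] : ((cS c k).2 < (cS c k).1)%N /\
    (i < (cS c k).1.-1 - (cS c k).2 < (cS c k).1)%N.
  move: Kw; rewrite /mirror_pair; case: (ltnP (cS c k).2 (cS c k).1) => //= rj.
  by rewrite [X in _ && X]ltnNge rj andbF.
have ij : (i < (cS c k).1)%N.
  by apply: (leq_trans ir); rewrite leq_subLR (leq_trans (leq_pred _))// leq_addl.
move: Ww; rewrite cwalk_mirror /= ij => Ww.
exists ((cS c k).1.-1 - i :: w)%N; split=> //=.
  move: tw; rewrite /ctree /= => /and3P[_ _ tw]; apply/and3P; split.
  - by case: (cS c k).1 ij => // j _; rewrite ltnS leq_subr.
  - by apply: contraTneq ir => <-; case: (cS c k).1 ij => // j ij; rewrite /= subKn// ltnn.
  rewrite (_ : subtree _ _ _ _ = subtree (cN (mirror c)) k.+1 [:: i] w)//.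
  by apply/esym/eq_subtree => v; rewrite /cN /mirror /= ij.
by move: ir; rewrite !ltn_subRL addnC.
Qed.

Lemma prob_left_le_right x : prob nu (visits_io left_words x) <= prob nu (visits_io right_words x).
Proof.
have mV K := measurable_visits_io K x.
rewrite -lee_fin -!probE// -(nu_mirror (mV left_words)); apply: le_measure; rewrite ?inE//.
  by rewrite -[X in measurable X]setTI; exact: measurable_mirror.
by move=> c h n; have [k [nk vk]] := h n; exists k; split=> //; exact: visits_mirror.
Qed.

Variable j0 : nat.
Hypothesis j0_gt1 : (1 < j0)%N.
Hypothesis mu_j0 : mu [set j0] <> 0%E.
Variable y : lattice d.
Hypothesis theta_y : theta [set y] <> 0%E.

(** The first child of [c_{-k-1}] belongs to the spine, and the second one, which
    thus lies to the right, makes a jump [y]. *)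
Definition jump_right k : set C :=
  [set c | cS c k = (j0, 0%N) /\ cX c (k.+1, [:: 1%N]) = y].

Lemma measurable_jump_right k : measurable (jump_right k).
Proof.
apply: measurable_andP; first exact: (dmeas_cS k [set s | s = (j0, 0%N)]).
exact: (dmeas_cX _ [set v | v = y]).
Qed.

Lemma visits_jump_right c k : jump_right k c ->
  visits_block right_words (cwalk c (k.+1, [::]) + y) c k.
Proof.
move=> [cSk cXk]; exists [:: 1%N]; split.
- by rewrite /ctree /= cSk /= j0_gt1.
- by rewrite cSk.
- by rewrite walkE walk_spine /= big_nat1 /= cXk.
Qed.

Lemma jump_right_depends k : depends
  (fun i => (i == iS k) || (i == iX (k.+1, [:: 1%N]))) (jump_right k).
Proof. by move=> c c' cc' [cSk cXk]; split; rewrite /cS /cX -cc' ?eqxx ?orbT. Qed.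

Local Notation q := (prob nu (jump_right 0)).

Lemma nu_jump_right k :
  nu (jump_right k) = (mu [set j0] * theta [set y])%E.
Proof.
rewrite (nu_indepI (law_indep lawP) (J1 := pred1 (iS k))
   (J2 := pred1 (iX (k.+1, [:: 1%N])))
   (A := [set c | cS c k = (j0, 0%N)]) (B := [set c | cX c (k.+1, [:: 1%N]) = y])).
- congr (_ * _)%E; last exact: (law_X lawP _ (fun v => v.2 = y)).
  by rewrite (law_S lawP) (ltn_trans _ j0_gt1).
- exact: (dmeas_cS k [set s | s = (j0, 0%N)]).
- exact: (dmeas_cX _ [set v | v = y]).
- by move=> c c' cc' /=; rewrite /cS cc' /=.
- by move=> c c' cc' /=; rewrite /cX cc' /=.
- by move=> i /eqP ->.
Qed.

Lemma q_gt0 : 0 < q.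
Proof.
rewrite lt_neqAle prob_ge0 andbT; apply/eqP => q0.
have : nu (jump_right 0) = 0%E by rewrite probE -?q0//; exact: measurable_jump_right.
by rewrite nu_jump_right => /eqP; rewrite mule_eq0 => /orP[]/eqP.
Qed.

Definition no_jump (s : seq nat) : set C := [set c | forall k, k \in s -> ~ jump_right k c].

Lemma measurable_no_jump s : measurable (no_jump s).
Proof.
apply: measurable_all => k; apply: measurable_impP; first exact: measurable_constP.
apply: measurable_notP; exact: measurable_jump_right.
Qed.

Lemma prob_no_jump s : uniq s -> prob nu (no_jump s) = (1 - q) ^+ size s.
Proof.
elim: s => [_|k s IH /= /andP[ks us]].
  rewrite expr0 (_ : no_jump _ = setT) /prob ?probability_setT//.
  by apply/seteqP; split.
rewrite exprS -IH//; apply: EFin_inj.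
have mN := measurable_no_jump s.
have mJ := measurable_jump_right k.
rewrite EFinM -!probE//; last exact: measurable_no_jump.
have -> : no_jump (k :: s) = ~` jump_right k `&` no_jump s.
  rewrite predeqE => c; split=> [h|[hk hs] l].
    by split=> [|l ls]; apply: h; rewrite inE ?eqxx ?ls ?orbT.
  by rewrite inE => /orP[/eqP ->//|]; exact: hs.
rewrite (nu_indepI (law_indep lawP) (measurableC mJ) mN
  (J1 := fun i => (i == iS k) || (i == iX (k.+1, [:: 1%N])))
  (J2 := fun i => if i is inl (inr l) then l \in s else
                  if i is inr (l.+1, _) then l \in s else false)).
- rewrite probability_setC// nu_jump_right -(nu_jump_right 0) probE ?EFinB//.
  exact: measurable_jump_right.
- by move=> c c' cc' h h'; apply: h; apply: (jump_right_depends _ h') => i /cc' ->.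
- move=> c c' cc' h l ls h'; apply: (h l ls); apply: (jump_right_depends _ h') => i.
  by move=> /orP[]/eqP ->; rewrite cc'.
- by move=> i /orP[]/eqP -> /=.
Qed.

(** The second Borel-Cantelli lemma along the indices selected by [H], in which
    the visits of a fixed trajectory of the spine will be taken. *)
Lemma jump_right_io (H : nat -> Prop) : (forall n, exists k, (n <= k)%N /\ H k) ->
  nu [set c | forall n, exists k, [/\ (n <= k)%N, H k & jump_right k c]] = 1%E.
Proof.
move=> Hio; set E := [set c | _].
have mE : measurable E.
  apply: measurable_all => n; apply: measurable_ex => k.
  rewrite (_ : [set c | _] = [set c | (n <= k)%N /\ (H k /\ jump_right k c)]).
    do 2 (apply: measurable_andP; first exact: measurable_constP).
    exact: measurable_jump_right.
  by rewrite predeqE => c; split=> [[]|[? []]].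
suff E0 : nu (~` E) = 0%E.
  by rewrite probE//; congr (_%:E); apply/prob1P.
apply: measure_negligible; first exact: measurableC.
pose F n := [set c | forall k, (n <= k)%N -> H k -> ~ jump_right k c].
have mF n : measurable (F n).
  apply: measurable_all => k; do 2 (apply: measurable_impP; first exact: measurable_constP).
  apply: measurable_notP; exact: measurable_jump_right.
apply: (@negligibleS _ _ _ nu (\bigcup_n F n)).
  move=> c /= nE; apply: contrapT => h; apply: nE => n; apply: contrapT => h'; apply: h.
  by exists n => // k nk Hk jk; apply: h'; exists k.
apply: negligible_bigcup => n; exists (F n); split=> //.
have lists m : exists s, [/\ size s = m, uniq s & forall k, k \in s -> (n <= k)%N /\ H k].
  elim: m => [|m [s [sm us hs]]]; first by exists [::].
  have [k [nk Hk]] := Hio (maxn n (\max_(l <- s) l).+1).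
  rewrite geq_max in nk; case/andP: nk => nk sk.
  exists (k :: s); split=> /=; first by rewrite sm.
    rewrite us andbT; apply/negP => ks; move: sk; rewrite ltnNge => /negP; apply.
    exact: (leq_bigmax_seq (F := id)).
  by move=> l; rewrite inE => /orP[/eqP ->|/hs].
have q1 : q <= 1 by apply: prob_le1; exact: measurable_jump_right.
have q0 := q_gt0.
have Fm m : prob nu (F n) <= (1 - q) ^+ m.
  have [s [<- us hs]] := lists m; rewrite -prob_no_jump// -lee_fin -!probE//; last first.
    exact: measurable_no_jump.
  apply: le_measure; rewrite ?inE//; first exact: measurable_no_jump.
  by move=> c h k /hs[nk Hk]; exact: h.
have bern m : (1 - q) ^+ m * (1 + m%:R * q) <= 1.
  elim: m => [|m IH]; first by rewrite expr0 mul0r addr0 mulr1.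
  apply: le_trans IH; rewrite exprSr -mulrA ler_wpM2l ?exprn_ge0 ?subr_ge0//.
  rewrite -natr1; have : 0 <= (m%:R + 1) * q ^+ 2.
    by rewrite mulr_ge0 ?exprn_ge0// ?addr_ge0// ltW.
  lra.
rewrite /= (probE nu (mF n)); congr (_%:E); apply/eqP; rewrite eq_le prob_ge0 andbT.
case: (leP (prob nu (F n)) 0) => // e0; exfalso.
set e := prob nu (F n) in Fm e0.
pose m := (Num.truncn (1 / (e * q))).+1.
have : 1 < m%:R * (e * q) by rewrite -ltr_pdivrMr ?mulr_gt0//; exact: truncnS_gt.
have := bern m; have := Fm m => h1 h2 h3.
have : e * (1 + m%:R * q) <= 1.
  by apply: le_trans h2; rewrite ler_wpM2r// addr_ge0 ?mulr_ge0// ltW.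
move: h3 e0; lra.
Qed.

(** The walk along the spine does not involve the sources that decide
    [jump_right]: freeze it, and apply [jump_right_io] to its visits of [x]. *)
Lemma prob_spine_le_right x :
  prob nu (visits_io spine_words x) <= prob nu (visits_io right_words (x + y)).
Proof.
pose J (i : idx) := if i is inr (_, [::]) then true else false.
have mA := measurable_visits_io right_words (x + y).
have mS := measurable_visits_io spine_words x.
have spE c k : visits_block spine_words x c k <-> cwalk c (k.+1, [::]) = x.
  split; first by move=> [w [_ /eqP -> ]].
  by exists [::].
have glE (c c' : C) k : cwalk (glue J c c') (k, [::]) = cwalk c (k, [::]) by rewrite !walk_spine.
have dS : depends J (visits_io spine_words x).
  move=> c c' cc' h n; have [k [nk /spE Wk]] := h n; exists k; split=> //.
  apply/spE; rewrite -Wk !walk_spine; congr (- _); apply: eq_bigr => i _.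
  by rewrite /cX cc'.
rewrite -lee_fin -!probE//.
apply: (@le_trans _ _ (nu (visits_io spine_words x `&` visits_io right_words (x + y)%R))).
  rewrite (nu_setI_glue (law_indep lawP) mA mS dS).
  rewrite (eq_integral (cst 1%E)) ?integral_cst ?mul1e// => c; rewrite inE => Sc.
  apply/eqP; rewrite eq_le probability_le1 ?andTb; last exact: measurable_glue_section.
  have Hio n : exists k, (n <= k)%N /\ cwalk c (k.+1, [::]) = x.
    by have [k [nk /spE]] := Sc n; exists k.
  rewrite /cst -(jump_right_io Hio); apply: le_measure; rewrite ?inE.
  - apply: measurable_all => n; apply: measurable_ex => k.
    rewrite (_ : [set c | _] = [set c' : C | (n <= k)%N /\ (cwalk c (k.+1, [::]) = x /\ jump_right k c')]).
      do 2 (apply: measurable_andP; first exact: measurable_constP).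
      exact: measurable_jump_right.
    by rewrite predeqE => c'; split=> [[]|[? []]].
  - exact: measurable_glue_section.
  move=> c' h n; have [k [nk Wk jk]] := h n; exists k; split=> //.
  by rewrite -Wk -(glE c c'); apply: visits_jump_right.
by apply: le_measure; rewrite ?inE//; exact: measurableI.
Qed.

Lemma visits_io_split x (c : C) : (forall k, ((cS c k).2 < (cS c k).1)%N) ->
  visits_io all_words x c ->
  [\/ visits_io left_words x c, visits_io right_words x c | visits_io spine_words x c].
Proof.
move=> rj h; apply: contrapT => nh.
have /not_visits_io[n1 h1] : ~ visits_io left_words x c.
  by move=> ?; apply: nh; constructor 1.
have /not_visits_io[n2 h2] : ~ visits_io right_words x c.
  by move=> ?; apply: nh; constructor 2.
have /not_visits_io[n3 h3] : ~ visits_io spine_words x c.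
  by move=> ?; apply: nh; constructor 3.
have [k []] := h (maxn n1 (maxn n2 n3)).
rewrite !geq_max => /and3P[k1 k2 k3] [[|i w] [tw _ Ww]].
  by apply: (h3 k k3); exists [::].
have [ir|ri|ri] := ltngtP i (cS c k).2.
- by apply: (h1 k k1); exists (i :: w); split=> //=; rewrite ir rj.
- by apply: (h2 k k2); exists (i :: w).
- by move: tw; rewrite /ctree /= ri eqxx andbF.
Qed.

Lemma negligible_rank_ge : nu.-negligible [set c | ~ forall k, ((cS c k).2 < (cS c k).1)%N].
Proof.
apply: (@negligibleS _ _ _ nu (\bigcup_k [set c : C | ((cS c k).1 <= (cS c k).2)%N])).
  move=> c /= h; apply: contrapT => h'; apply: h => k; rewrite ltnNge; apply/negP => kr.
  by apply: h'; exists k.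
apply: negligible_bigcup => k; exists [set c : C | ((cS c k).1 <= (cS c k).2)%N]; split=> //.
  exact: (dmeas_cS k [set s | (s.1 <= s.2)%N]).
apply: (nu_countable0 (Q := fun s => (s.1 <= s.2)%N) (@dmeas_cS d k)) => -[j i] ji.
by rewrite (law_S lawP) ltnNge ji.
Qed.

Hypothesis theta_gen : not_supported_by_strict_subgroup theta.

(** One of the three parts visits [0] infinitely often with positive probability,
    hence almost surely, and in each case the right side does so too. *)
Lemma recurrent_right x : prob nu (visits_io all_words 0) = 1 ->
  prob nu (visits_io right_words x) = 1.
Proof.
move=> all1; have mV K a := @measurable_visits_io d K a.
case: (visits_io_01 lawP right_words theta_gen 0) => [r0|]; last first.
  by rewrite (visits_io_const lawP right_words theta_gen x).
case: (visits_io_01 lawP left_words theta_gen 0) => [l0|l1]; last first.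
  have := prob_left_le_right 0; rewrite l1 r0; lra.
case: (visits_io_01 lawP spine_words theta_gen 0) => [s0|s1]; last first.
  have := prob_spine_le_right 0; rewrite s1.
  rewrite (visits_io_const lawP right_words theta_gen) r0; lra.
exfalso.
have : nu (visits_io all_words (0 : lattice d)) = 0%E.
  apply: measure_negligible => //.
  apply: (@negligibleS _ _ _ nu ([set c | ~ forall k, ((cS c k).2 < (cS c k).1)%N] `|`
    (visits_io left_words 0 `|` (visits_io right_words 0 `|` visits_io spine_words 0)))).
    move=> c /= ic; have [rj|] := pselect (forall k, ((cS c k).2 < (cS c k).1)%N); last by left.
    by right; have [] := visits_io_split rj ic; [left|right; left|right; right].
  have neg K : prob nu (visits_io K 0) = 0 -> nu.-negligible (visits_io K 0).
    by move=> K0; exists (visits_io K 0); split=> //; rewrite probE// K0.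
  apply: negligibleU; first exact: negligible_rank_ge.
  by apply: negligibleU; [exact: neg|apply: negligibleU; exact: neg].
rewrite probE// all1 => -[] /eqP; by rewrite oner_eq0.
Qed.
End RightSide.

(** * Offspring and jump distributions *)

Section Laws.
Local Open Scope classical_set_scope.
Variable R : realType.

Section Offspring.
Variable mu : probability nat R.
Hypothesis mu_critical : critical mu.

Lemma offspring_total : (\sum_(0 <= k <oo) mu [set k] = 1)%E.
Proof.
rewrite -(probability_setT mu) -measure_semi_bigcup//.
- by congr (mu _); apply/seteqP; split=> // k _; exists k.
- by move=> k l _ _ [x [/= -> ->]].
Qed.

(** Otherwise the mean would be [mu 1], and [mu] would be the point mass at [1]. *)
Lemma offspring_ge2 : exists2 j, (1 < j)%N & mu [set j] <> 0%E.
Proof.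
have [mean1 not1] := mu_critical; apply: contrapT => h.
have h' j : (1 < j)%N -> mu [set j] = 0%E.
  by move=> j1; apply: contrapT => mj; apply: h; exists j.
apply: not1 => A; have m1 : mu [set 1%N] = 1%E.
  rewrite -mean1 (nneseriesD1 (n := 1))//; last by move=> k _; rewrite mule_ge0// lee_fin.
  rewrite mul1e eseries0 ?adde0// => k _ /=; case: k => [_|[//|k] _].
    by rewrite mul0e.
  by rewrite h' ?mule0.
rewrite diracE; case: (pselect (A 1%N)) => A1.
  rewrite mem_set//=; apply/eqP; rewrite eq_le probability_le1//= -m1.
  by apply: le_measure; rewrite ?inE// => _ ->.
rewrite memNset//=; apply/eqP; rewrite -measure_le0.
have := probability_setC mu (A := [set 1%N]) I; rewrite m1 subee// => <-.
by apply: le_measure; rewrite ?inE// => k Ak /= k1; apply: A1; rewrite -k1.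
Qed.

(** Without mass at [0] the mean would be at least [1 + mu j], where [1 < j]. *)
Lemma offspring_0 : mu [set 0%N] <> 0%E.
Proof.
have [j j1 mj] := offspring_ge2; have [mean1 _] := mu_critical => m0.
have muf k : mu [set k] = (fine (mu [set k]))%:E by rewrite fineK// fin_num_measure.
have : ((\sum_(0 <= k <oo) mu [set k]) + mu [set j] <=
    \sum_(0 <= k <oo) (k%:R%:E * mu [set k]))%E.
  rewrite (nneseriesD1 (n := j))// [leRHS](nneseriesD1 (n := j))//; last first.
    by move=> k _; rewrite mule_ge0// lee_fin.
  rewrite addeAC; apply: leeD.
    rewrite muf -EFinD -EFinM lee_fin.
    have : 0 <= fine (mu [set j]) by rewrite fine_ge0.
    have : 2 <= j%:R :> R by rewrite ler_nat.
    nra.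
  apply: lee_nneseries => // k _; case: k => [|k]; first by rewrite m0 mule0.
  rewrite -[leLHS]mul1e; apply: lee_wpmul2r => //.
  by rewrite lee_fin ler1n.
rewrite mean1 offspring_total muf -EFinD lee_fin => h.
apply: mj; rewrite muf; congr (_%:E); apply/eqP; rewrite eq_le fine_ge0// andbT; lra.
Qed.

End Offspring.

(** A point mass at [z] has mean [z]. *)
Lemma centered_two_points d (theta : probability (lattice d) R) :
  centered theta -> (forall Q : set (lattice d), (forall x, Q x -> theta [set x] = 0%E) ->
    theta Q = 0%E) ->
  forall z, z <> 0 -> exists2 y, theta [set y] <> 0%E & y <> z.
Proof.
move=> thc th0 z z0; apply: contrapT => h.
have hz : theta [set y | y <> z] = 0%E.
  by apply: th0 => y yz; apply: contrapT => ty; apply: h; exists y.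
apply: z0; apply/rowP => i; rewrite mxE.
have := thc i; rewrite unlock.
rewrite (ae_eq_integral (cst (@lattice_coord R d i z)%:E)) //.
  rewrite integral_cst// [X in (_ * X)%E](_ : _ = 1%E) ?mule1; last exact: probability_setT.
  by move=> [] /eqP; rewrite /lattice_coord intr_eq0 => /eqP.
exists [set y | y <> z]; split=> // y /= h' yz; apply: h'.
by rewrite yz.
Qed.

Lemma visits_pinfty d (A : set vertex) (W : vertex -> lattice d) x :
  infinite_set [set u | A u /\ W u = x] -> visits R A W x = +oo%E.
Proof.
move=> inf; apply/eqyP => r r0.
have [B BA nB] := infinite_set_fset (Num.truncn r).+1 inf.
apply: esum_ge; exists [set` B]; first by split=> // u /BA[].
rewrite (eq_fsbigr (cst 1%E)); last first.
  by move=> u; rewrite inE => /BA[_ ->]; rewrite eqxx.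
rewrite fsbig_finite//= set_fsetK sumEFin lee_fin.
rewrite -(natr_sum _ _ _ (fun=> 1%N)) sum1_size.
by rewrite (le_trans (ltW (truncnS_gt r)))// ler_nat.
Qed.

Lemma visits_fin d (A : set vertex) (W : vertex -> lattice d) x :
  finite_set [set u | A u /\ W u = x] -> (visits R A W x < +oo)%E.
Proof.
move=> fin; rewrite /visits.
have -> : \esum_(u in A) ((W u == x)%:R)%:E =
    \esum_(u in [set u | A u /\ W u = x]) (1 : \bar R)%E.
  rewrite esum_mkcond [RHS]esum_mkcond; apply: eq_esum => u _.
  have [Au|nAu] := pselect (A u); last by rewrite !memNset// => -[].
  rewrite (mem_set Au); have [Wx|nW] := pselect (W u = x).
    by rewrite Wx eqxx mem_set.
  by rewrite memNset; [rewrite (introF eqP nW)|case].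
rewrite esum_fset// fsbig_finite//=.
by apply: lte_sum_pinfty => u _; rewrite ltry.
Qed.

End Laws.

(** * From the sample space to configurations *)

Section Transfer.
Local Open Scope classical_set_scope.
Variables (R : realType) (d : nat) (mu : probability nat R)
  (theta : probability (lattice d) R).
Variables (dO : measure_display) (Omega : measurableType dO) (P : probability Omega R)
  (N : vertex -> {RV P >-> nat}) (S : nat -> {RV P >-> (nat * nat)%type})
  (X : vertex -> {RV P >-> lattice d}).
Hypothesis NSX_field : is_Tinf_field mu theta N S X.
Local Notation C := (config idx (val_type d)).

Definition sources (omega : Omega) : C := fun i => match i with
  | inl (inl u) => (N u omega, 0%N, 0)
  | inl (inr k) => (S k omega, 0)
  | inr u => (0%N, 0%N, X u omega)
  end.

Lemma measurable_nat2 (Q : set (nat * nat)) : measurable Q.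
Proof.
rewrite (_ : Q = [set s | exists t, s = t /\ Q t]).
  apply: measurable_ex => -[j i]; apply: measurable_andP; last exact: measurable_constP.
  rewrite (_ : [set _ | _] = [set j] `*` [set i]).
    exact: measurableX.
  by rewrite predeqE => -[a b]; split=> [[-> ->]|[/= -> ->]].
by rewrite predeqE => s; split=> [Qs|[t [-> ?]]]//; exists s.
Qed.

Lemma dmeas_sources i : dmeas (fun omega => sources omega i).
Proof.
have mRV d' (T : measurableType d') (f : {RV P >-> T}) (Q : set T) :
    measurable Q -> measurable (f @^-1` Q).
  by move=> mQ; rewrite -[X in measurable X]setTI; exact: measurable_funPT.
case: i => [[u|k]|u] Q /=.
- exact: (mRV _ _ (N u) [set n | Q (n, 0%N, 0)]).
- by apply: (mRV _ _ (S k) [set s | Q (s, 0)]); exact: measurable_nat2.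
- exact: (mRV _ _ (X u) [set x | Q (0%N, 0%N, x)]).
Qed.

Lemma measurable_sources : measurable_fun [set: Omega] sources.
Proof. by apply: measurable_config_fun; exact: dmeas_sources. Qed.

Definition sources_law : probability C R :=
  distribution P (HB.pack_for {mfun Omega >-> C} sources
    (isMeasurableFun.Build _ _ _ _ sources measurable_sources)).

Lemma sources_lawE (A : set C) : sources_law A = P (sources @^-1` A).
Proof. by []. Qed.

Lemma sources_tree_law : tree_law mu theta sources_law.
Proof.
case: NSX_field => lN lS lX ind; split.
- move=> s a us; rewrite sources_lawE.
  pose A (i : vertex + nat + vertex) := sources @^-1` [set c | a i (c i)].
  have := ind (seq_fset tt (s : seq (vertex + nat + vertex))) A.
  rewrite (_ : \bigcap_(_ in _) _ = sources @^-1` rect s a); last first.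
    rewrite predeqE => w; split=> h i si; apply: h.
      by apply/(@idP (i \in seq_fset tt _)); rewrite seq_fsetE.
    by have := seq_fsetE tt s i; rewrite [LHS](_ : _ = true).
  move=> ->; last first.
    move=> [[u|k]|u] _ /=.
    + by exists [set n | a (iN u) (n, 0%N, 0)] => //; rewrite setTI.
    + exists [set v | a (iS k) (v, 0)]; last by rewrite setTI.
      exact: measurable_nat2.
    + by exists [set x | a (iX u) (0%N, 0%N, x)] => //; rewrite setTI.
  apply: perm_big; apply: (perm_trans (seq_fset_perm _ _)).
  by rewrite undup_id.
- by move=> u Q; exact: (lN u [set n | Q (n, 0%N, 0)]).
- move=> k j i; rewrite sources_lawE -[LHS]/(P (S k @^-1` [set (j, i)])) lS.
  case: ifP => // ij; rewrite /size_biased.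
  rewrite -[mu _]fineK ?fin_num_measure// -!EFinM; congr (_%:E).
  by field; rewrite pnatr_eq0 -lt0n (leq_ltn_trans _ ij).
- by [].
- by move=> u Q; exact: (lX u [set x | Q (0%N, 0%N, x)]).
Qed.

Lemma negligible_sources (Z : set C) : sources_law.-negligible Z ->
  P.-negligible (sources @^-1` Z).
Proof.
move=> [A [mA A0 ZA]]; exists (sources @^-1` A); split=> //.
  by rewrite -[X in measurable X]setTI; exact: measurable_sources.
by move=> w; exact: ZA.
Qed.
End Transfer.

(** * The future of the cursor *)

Section FutureVisits.
Local Open Scope classical_set_scope.
Variable d : nat.
Local Notation C := (config idx (val_type d)).

Definition future (c : C) : set vertex := tree_future (cN c) (cS c).

Definition escapes_future : set C :=
  [set c | forall u, future c u -> cwalk c u <> 0].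

Lemma measurable_future u : measurable [set c | future c u].
Proof.
rewrite (_ : [set _ | _] = [set c | tree (cN c) (cS c) u /\
    (depth_first_le (cS c) cursor u /\ u <> cursor)]); last first.
  by rewrite predeqE => c; split=> [[]|[? []]].
apply: measurable_andP.
  rewrite (_ : [set _ | _] = [set c | ctree c u]).
    exact: (dmeas_ctree _ [set b | b]).
  by rewrite predeqE => c; split=> /in_treebP.
apply: measurable_andP; last exact: measurable_constP.
apply: measurable_orP; first exact: measurable_constP.
apply: measurable_ex => w; apply: measurable_ex => a; apply: measurable_ex => b.
rewrite (_ : [set _ | _] = [set c | ([/\ last_common_ancestor w cursor u,
    parent a = w /\ parent b = w & ancestor_or_self a cursor /\ ancestor_or_self b u]) /\
    (rank (cS c) a < rank (cS c) b)%N]); last first.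
  by rewrite predeqE => c; split=> [[]|[[]]].
apply: measurable_andP; first exact: measurable_constP.
have mr v : dmeas (fun c : C => rank (cS c) v).
  case: v => k [|i v]; last exact: dmeas_cst.
  by apply: (dmeas_comp snd); exact: dmeas_cS.
exact: (dmeas_op ltn (mr a) (mr b) [set t | t]).
Qed.

Lemma measurable_escapes_future : measurable escapes_future.
Proof.
apply: measurable_all => u; apply: measurable_impP; first exact: measurable_future.
exact: (dmeas_cwalk _ [set w | w <> 0]).
Qed.

Lemma iter_parent_spine n k : iter n parent (k, [::]) = (n + k, [::])%N.
Proof. by elim: n => // n IH; rewrite iterS IH. Qed.

Lemma iter_parent_fst n u : (u.1 <= (iter n parent u).1)%N.
Proof.
elim: n => // n IH; apply: (leq_trans IH); rewrite iterS.
by case: (iter n parent u) => k [|i w] //=.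
Qed.

Lemma ancestor_word k w : ancestor_or_self (k, [::]) (k, w).
Proof.
elim/last_ind: w => [|w i [n IH]]; first by exists 0%N.
by exists n.+1; rewrite iterSr parent_rcons.
Qed.

(** The last common ancestor of such a vertex and of the cursor is [c_{-k-1}],
    and the cursor descends from its child [c_{-k}], which comes first. *)
Lemma right_future c k w : ctree c (k.+1, w) -> right_words (cS c k) w ->
  future c (k.+1, w).
Proof.
case: w => // i w tw /= ri; split=> //; first exact/in_treebP.
right; exists (k.+1, [::]), (k, [::]), (k.+1, [:: i]); split=> //.
- split.
  + by exists k.+1; rewrite iter_parent_spine addn0.
  + exact: ancestor_word.
  + move=> z [n zn] [m zm]; have := iter_parent_fst m (k.+1, i :: w).
    rewrite zm -zn iter_parent_spine addn0 /= => kn.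
    by exists (n - k.+1)%N; rewrite iter_parent_spine subnK.
- split; first by exists k; rewrite iter_parent_spine addn0.
  elim/last_ind: (w) => [|v j [n IH]]; first by exists 0%N.
  by exists n.+1; rewrite iterSr -rcons_cons parent_rcons.
Qed.

Lemma infinite_visits K x (c : C) (A : set vertex) : visits_io K x c ->
  (forall k w, ctree c (k.+1, w) -> K (cS c k) w -> A (k.+1, w)) ->
  infinite_set [set u | A u /\ cwalk c u = x].
Proof.
move=> io KA /finite_fsetP[B AB].
have [k [Bk [w [tw Kw Ww]]]] := io (\max_(u <- enum_fset B) u.1)%N.
have : [set` B] (k.+1, w) by rewrite -AB; split=> //; exact: KA.
move=> /= kB; have : (k.+1 <= \max_(u <- enum_fset B) u.1)%N.
  exact: (leq_bigmax_seq (F := fun u : vertex => u.1) _ kB).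
by move=> /leq_trans /(_ Bk); rewrite ltnn.
Qed.
End FutureVisits.

(** * Recurrence and transience *)

Lemma negligible_not_all (R : realType) (d : nat)
    (nu : probability (config idx (val_type d)) R) (T : countType)
    (F : T -> set (config idx (val_type d))) :
  (forall t, measurable (F t)) -> (forall t, prob nu (F t) = 1) ->
  (nu.-negligible [set c | ~ forall t, F t c])%classic.
Proof.
move=> mF F1; apply: (@negligibleS _ _ _ nu [set c | exists t, ~ F t c]%classic).
  move=> c /= h; apply: contrapT => h'; apply: h => t.
  by apply: contrapT => nF; apply: h'; exists t.
apply: negligible_ex => t; exists (~` F t)%classic; split=> //; first exact: measurableC.
exact/prob1P.
Qed.

Theorem proposition1p1 (R : realType) (d : nat)
  (mu : probability nat R) (alpha : R)
  (mu_critical : critical mu)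
  (alpha_gt1 : 1 < alpha) (alpha_le2 : alpha <= 2)
  (mu_dom : dom alpha mu)
  (theta : probability (lattice d) R)
  (theta_centered : centered theta)
  (theta_moments : finite_second_moments theta)
  (theta_cov : covariance_mx theta \in unitmx)
  (theta_subgroup : not_supported_by_strict_subgroup theta)
  (dO : measure_display) (Omega : measurableType dO)
  (P : probability Omega R)
  (N : vertex -> {RV P >-> nat})
  (S : nat -> {RV P >-> (nat * nat)%type})
  (X : vertex -> {RV P >-> lattice d})
  (NSX_field : is_Tinf_field mu theta N S X) :
  [/\ P (Esc N S X) = 0%E ->
        {ae P, forall omega, forall x : lattice d,
          visits R (Tinf N S omega) (WTinf X omega) x = +oo%E},
      (0 < P (Esc N S X))%E ->
        {ae P, forall omega, forall x : lattice d,
          (visits R (Tinf N S omega) (WTinf X omega) x < +oo)%E},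
      P (Esc N S X) = 0%E <-> P (Esc_plus N S X) = 0%E &
      P (Esc N S X) = 0%E ->
        {ae P, forall omega, forall x : lattice d,
          visits R (Tplus N S omega) (WTinf X omega) x = +oo%E}].
Proof.
have [mean1 _] := mu_critical.
have [j0 j0_gt1 mu_j0] := offspring_ge2 mu_critical.
have mu_0 := offspring_0 mu_critical.
have lawP := sources_tree_law NSX_field.
set nu := sources_law N S X in lawP.
have theta_supp := centered_two_points theta_centered (theta_countable0 lawP).
have [y theta_y] : exists y, theta [set y]%classic <> 0%E.
  apply: contrapT => h; have := probability_setT theta.
  rewrite (theta_countable0 lawP) => [/eqP|x _]; first by rewrite eq_sym onee_eq0.
  by apply: contrapT => tx; apply: h; exists x.
have mV K x := @measurable_visits_io d K x.
have EscE : Esc N S X = (sources N S X @^-1` @escapes d)%classic.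
  by rewrite predeqE => w; split=> h u /in_treebP; exact: h.
have PEsc : P (Esc N S X) = nu (@escapes d) by rewrite EscE.
have PEscp : P (Esc_plus N S X) = nu (@escapes_future d) by [].
have recR : P (Esc N S X) = 0%E -> forall x, prob nu (visits_io right_words x) = 1.
  rewrite PEsc => E0 x; apply: (recurrent_right lawP j0_gt1 mu_j0 theta_y theta_subgroup).
  apply: (recurrent_of_avoids0 lawP j0_gt1 mu_j0 mu_0 theta_supp).
  exact: (avoids0_of_escapes lawP mu_0 E0).
have aeR : P (Esc N S X) = 0%E ->
    {ae P, forall omega, forall x : lattice d, visits_io right_words x (sources N S X omega)}.
  move=> E0; apply: (negligible_sources (Z := [set c | ~ forall x, visits_io right_words x c]%classic)).
  by apply: negligible_not_all => x; [exact: mV|exact: recR].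
split.
- move=> /aeR; apply: negligibleS => w /= h h'; apply: h => x.
  apply: visits_pinfty; apply: (infinite_visits (h' x)) => k v tv _.
  exact/in_treebP.
- move=> Epos.
  have all0 : prob nu (visits_io all_words 0) = 0.
    case: (visits_io_01 lawP all_words theta_subgroup 0) => // all1.
    suff E0 : P (Esc N S X) = 0%E by rewrite E0 ltxx in Epos.
    rewrite PEsc; apply/eqP; rewrite -measure_le0.
    have <- : nu (~` visits_io all_words 0)%classic = 0%E.
      exact/prob1P.
    apply: le_measure; rewrite ?inE.
    + exact: measurable_escapes.
    + exact: measurableC.
    + move=> c ec ic; have : (@escapes d `&` visits_io all_words 0)%classic c by [].
      by rewrite escapes_not_io.
  have : (P.-negligible (sources N S X @^-1` ([set c | exists x, visits_io all_words x c] `|`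
     [set c | ~ forall k p, finite_set [set w | subtree (cN c) k p w]])))%classic.
    apply: negligible_sources; apply: negligibleU; last first.
      exact: (ae_finite_bushes lawP mean1 j0_gt1 mu_j0).
    apply: negligible_ex => x; exists (visits_io all_words x); split=> //.
    by rewrite [LHS](probE nu (mV _ _)) (visits_io_const lawP all_words theta_subgroup) all0.
  apply: negligibleS => w /= h; have [fin|nfin] := pselect
    (forall k p, finite_set [set v | subtree (cN (sources N S X w)) k p v]%classic); last by right.
  left; apply: contrapT => h'; apply: h => x; apply: visits_fin.
  have nio : ~ visits_io all_words x (sources N S X w) by move=> io; apply: h'; exists x.
  by apply: sub_finite_set (finite_visits fin nio) => u [/in_treebP tu Wu].
- rewrite PEsc PEscp; split=> E0.
    apply/eqP; rewrite -measure_le0.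
    have <- : nu (~` visits_io right_words 0)%classic = 0%E.
      by apply/prob1P => //; apply: recR; rewrite PEsc.
    apply: le_measure; rewrite ?inE.
    + exact: measurable_escapes_future.
    + exact: measurableC.
    + move=> c ec /(_ 0%N)[k [_ [v [tv rv Wv]]]].
      by apply: (ec (k.+1, v)) => //; exact: right_future.
  apply/eqP; rewrite -measure_le0 -E0; apply: le_measure; rewrite ?inE.
  + exact: measurable_escapes.
  + exact: measurable_escapes_future.
  + by move=> c ec u [/in_treebP tu _ uc]; exact: ec.
- move=> /aeR; apply: negligibleS => w /= h h'; apply: h => x.
  apply: visits_pinfty; apply: (infinite_visits (h' x)) => k v tv rv.
  exact: (right_future tv rv).
Qed.
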